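(* Let $\Omega\subset\mathbb R^2$ be a rectangle with periodic boundary conditions and $\mathcal T_h$ a conforming Cartesian rectangular mesh; let $p\ge1$ and $m\in\{p-1,p\}$. Let $\rho_h\in V_h^p$ have positive nodal values and $\eta_h\in V_h^0$, $\eta_h\ge0$, both fixed in time. Let $(\boldsymbol u_h,\boldsymbol B_h,e_h,\boldsymbol J_h,\boldsymbol E_h)(t)\in X_h^p\times\mathcal B_h^m\times V_h^p\times\mathcal A_h^m\times\mathcal A_h^m$ solve the semidiscrete magnetic–velocity system $$\begin{aligned} (\rho_h\partial_t\boldsymbol u_h,\boldsymbol v_h)_{X,h}-\mathcal C_h(\boldsymbol v_h,\boldsymbol B_h;\boldsymbol J_h)&=0&&\forall\boldsymbol v_h\in X_h^p,\\ (\partial_t\boldsymbol B_h,\boldsymbol C_h)_{\mathcal B,h}+(\nabla\times\boldsymbol E_h,\boldsymbol C_h)_{\mathcal B,h}&=0&&\forall\boldsymbol C_h\in\mathcal B_h^m,\\ (\rho_h\partial_te_h,v_h)_{V,h}-(\eta_h|\boldsymbol J_h|^2,v_h)_{V,h}&=0&&\forall v_h\in V_h^p,\\ (\boldsymbol J_h,\boldsymbol\chi_h)_{\mathcal A,h}-(\boldsymbol B_h,\nabla\times\boldsymbol\chi_h)_{\mathcal B,h}&=0&&\forall\boldsymbol\chi_h\in\mathcal A_h^m,\\ (\boldsymbol E_h,\boldsymbol G_h)_{\mathcal A,h}-\mathcal C_h(\boldsymbol u_h,\boldsymbol B_h;\boldsymbol G_h)-(\eta_h\boldsymbol J_h\cdot\boldsymbol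 G_h,1)_{V,h}&=0&&\forall\boldsymbol G_h\in\mathcal A_h^m . \end{aligned}$$ If the initial in-plane magnetic field $\boldsymbol B_{\parallel,h}(0)$ belongs to the global space $R_h^m$ and is elementwise divergence-free, then for all later times $t$ $$\boldsymbol B_{\parallel,h}(t)\in R_h^m,\qquad \nabla\cdot\boldsymbol B_{\parallel,h}(t)=0\quad\text{on each }K\in\mathcal T_h .$$ The same statement holds (for all stages and all time levels) for explicit Runge–Kutta time stepping of this system, in which the magnetic increments are linear combinations of the residuals $-\nabla\times\boldsymbol E_h^{(i)}$ determined by the second equation, with $\boldsymbol E_h^{(i)}\in\mathcal A_h^m$ the electric field reconstructed at the stage values.
   Context: **Mesh.** Each $K\in\mathcal T_h$ is an axis-parallel rectangle with side lengths $h_{x,K},h_{y,K}$, image of $\widehat K=[-1,1]^2$ under the affine map $F_K$; $J_K=h_{x,K}h_{y,K}/4$. $\mathbb Q^{a,b}(K)$: polynomials of degree $\le a$ in $x$ and $\le b$ in $y$; $\mathbb Q^k=\mathbb Q^{k,k}$. For vector fields $\boldsymbol a=(a_x,a_y,a_z)$ depending on $(x,y)$: $\nabla\times\boldsymbol a=(\partial_ya_z,-\partial_xa_z,\partial_xa_y-\partial_ya_x)^T$; $\nabla\cdot\boldsymbol B_\parallel=\partial_xB_x+\partial_yB_y$. **Spaces** (periodic). $V_h^k=\{v\in L^2(\Omega):v|_K\in\mathbb Q^k(K)\}$; $W_h^{k+1}=\{w\in H^1(\Omega):w|_K\in\mathbb Q^{k+1}(K)\}$; $N_h^k=\{\boldsymbol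 g\in H(\mathrm{curl};\Omega):\boldsymbol g|_K\in\mathbb Q^{k,k+1}(K)\times\mathbb Q^{k+1,k}(K)\}$; $R_h^k=\{\boldsymbol r\in H(\mathrm{div};\Omega):\boldsymbol r|_K\in\mathbb Q^{k+1,k}(K)\times\mathbb Q^{k,k+1}(K)\}$. Then $X_h^p=(V_h^p)^3$, $\mathcal B_h^m=R_h^m\times V_h^m$ (in-plane components $\boldsymbol B_{\parallel,h}\in R_h^m$, out-of-plane $B_{z,h}\in V_h^m$), $\mathcal A_h^m=N_h^m\times W_h^{m+1}$ (in-plane, out-of-plane). The curl maps $\mathcal A_h^m$ into $\mathcal B_h^m$. **Quadratures.** $\xi^{(r)}_i,\omega_i^{(r)}$ ($0\le i\le r$): Gauss–Lobatto–Legendre (GLL) nodes/weights on $[-1,1]$ with $r+1$ points ($r\ge1$). $\zeta_i^{(k)},\varpi_i^{(k)}$ ($0\le i\le k$): $(k+1)$-point Gauss–Legendre rule. All products below are sums over elements $K$ of element contributions in which all functions are evaluated by their values from inside $K$ (points on $\widehat K$ are mapped by $F_K$): - $(f,g)_{V,h}$: on $K$, $J_K\sum_{i,j=0}^p\omega^{(p)}_i\omega_j^{(p)}(fg)(\xi_i^{(p)},\xi_j^{(p)})$ (degree-$p$ GLL rule; also applied to products of several functions). ''Nodal values'' of functions in $V_h^p$ are values at these points. - $(\rho_h\boldsymbol v,\boldsymbol z)_{X,h}=\sum_{d=x,y,z}(\rho_hv_d,z_d)_{V,h}$. - $(\boldsymbol F,\boldsymbol G)_{\mathcal A,h}$: on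 $K$, $J_K\sum_{i=0}^m\sum_{j=0}^{m+1}\varpi_i^{(m)}\omega_j^{(m+1)}(F_xG_x)(\zeta_i^{(m)},\xi_j^{(m+1)})+J_K\sum_{i=0}^{m+1}\sum_{j=0}^{m}\omega_i^{(m+1)}\varpi_j^{(m)}(F_yG_y)(\xi_i^{(m+1)},\zeta_j^{(m)})+J_K\sum_{i,j=0}^{m+1}\omega_i^{(m+1)}\omega_j^{(m+1)}(F_zG_z)(\xi_i^{(m+1)},\xi_j^{(m+1)})$. - $(\boldsymbol C,\boldsymbol D)_{\mathcal B,h}$: componentwise tensor Gauss rules which integrate products of functions in $\mathcal B_h^m$ exactly, so that it equals $\int_\Omega\boldsymbol C\cdot\boldsymbol D\,dx$ on $\mathcal B_h^m$. - $\mathcal C_h(\boldsymbol v_h,\boldsymbol B_h;\boldsymbol G_h)=(-\boldsymbol v_h\times\boldsymbol B_h,\boldsymbol G_h)_{\mathcal A,h}$, the cross product in $\mathbb R^3$ being evaluated pointwise at the quadrature nodes. **Explicit Runge–Kutta stepping.** At each stage $\boldsymbol J_h$ and $\boldsymbol E_h$ are computed from the stage values of $\boldsymbol u_h,\boldsymbol B_h$ by the last two equations, and the stage and final magnetic fields have the form $\boldsymbol B_h^{(i)}=\boldsymbol B_h^n-\tau\sum_{j<i}a_{ij}\nabla\times\boldsymbol E_h^{(j)}$, $\boldsymbol B_h^{n+1}=\boldsymbol B_h^n-\tau\sum_jb_j\nabla\times\boldsymbol E_h^{(j)}$ with real coefficients. *)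

(* Defs.v *)
From HB Require Import structures.
From mathcomp Require Import all_boot all_order all_algebra.
From mathcomp Require Import all_classical all_reals all_analysis.
Set Implicit Arguments.
Unset Strict Implicit.
Unset Printing Implicit Defensive.
Import Order.TTheory GRing.Theory Num.Theory.
Import numFieldNormedType.Exports.
Local Open Scope classical_set_scope.
Local Open Scope ring_scope.

(* A partition of the rectangle [mx0, mx1] x [my0, my1], whose opposite sides
   are identified, into the closed axis-parallel rectangles
   [ex0 K, ex1 K] x [ey0 K, ey1 K].  Conformity is the absence of hanging
   nodes, also across the periodic boundary: a vertex of (a periodic translate
   of) an element that lies on an element K is a vertex of K. *)
Record mesh (R : realType) := Mesh {
  mx0 : R; mx1 : R; my0 : R; my1 : R;
  elt : finType;
  ex0 : elt -> R; ex1 : elt -> R; ey0 : elt -> R; ey1 : elt -> R;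
  mesh_domx : mx0 < mx1;
  mesh_domy : my0 < my1;
  mesh_eltx : forall K, ex0 K < ex1 K;
  mesh_elty : forall K, ey0 K < ey1 K;
  mesh_cover : `[mx0, mx1]%classic `*` `[my0, my1]%classic =
    \bigcup_(K in [set: elt])
      (`[ex0 K, ex1 K]%classic `*` `[ey0 K, ey1 K]%classic);
  mesh_disjoint : forall K L, K != L ->
    (`]ex0 K, ex1 K[%classic `*` `]ey0 K, ey1 K[%classic) `&`
    (`]ex0 L, ex1 L[%classic `*` `]ey0 L, ey1 L[%classic) = set0;
  mesh_conforming : forall K L (s t : int) (x y : R),
    (x = ex0 L \/ x = ex1 L) -> (y = ey0 L \/ y = ey1 L) ->
    let x' := x + s%:~R * (mx1 - mx0) in
    let y' := y + t%:~R * (my1 - my0) in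
    ex0 K <= x' <= ex1 K -> ey0 K <= y' <= ey1 K ->
    (x' = ex0 K \/ x' = ex1 K) /\ (y' = ey0 K \/ y' = ey1 K) }.

Section mesh_geometry.
Context {R : realType} (M : mesh R).

Definition dom : set (R * R) :=
  `[mx0 M, mx1 M]%classic `*` `[my0 M, my1 M]%classic.

Definition cell (K : elt M) : set (R * R) :=
  `[ex0 K, ex1 K]%classic `*` `[ey0 K, ey1 K]%classic.

Definition hx (K : elt M) : R := ex1 K - ex0 K.
Definition hy (K : elt M) : R := ey1 K - ey0 K.
Definition jac (K : elt M) : R := hx K * hy K / 4.

(* F_K : [-1, 1]^2 -> K is (s, t) |-> (Fx K s, Fy K t). *)
Definition Fx (K : elt M) (s : R) : R := ex0 K + hx K / 2 * (s + 1).
Definition Fy (K : elt M) (s : R) : R := ey0 K + hy K / 2 * (s + 1).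

(* A field on the broken mesh.  [f K] gives the values from inside K; these are
   the values on K of a function defined on the whole plane, so that for fields
   which are polynomial on each K the one-sided derivatives at the boundary of
   K are ordinary derivatives. *)
Definition bfield := elt M -> R -> R -> R.

(* (a_x, a_y, a_z), grouped as (in-plane pair, out-of-plane component). *)
Definition vfield := ((bfield * bfield) * bfield)%type.

End mesh_geometry.

Section differential_operators.
Context {R : realType}.

Definition dx (f : R -> R -> R) : R -> R -> R :=
  fun x y => derive1 (fun s => f s y) x.
Definition dy (f : R -> R -> R) : R -> R -> R :=
  fun x y => derive1 (fun s => f x s) y.

(* Iterated partial derivatives; [true] stands for d/dx, [false] for d/dy. *)
Definition partials (w : seq bool) (f : R -> R -> R) : R -> R -> R :=
  foldr (fun b g => if b then dx g else dy g) f w.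

Definition smooth (f : R -> R -> R) : Prop := forall w : seq bool,
  [/\ continuous (fun z : R * R => partials w f z.1 z.2),
      forall x y, derivable (fun s => partials w f s y) x 1
    & forall x y, derivable (fun s => partials w f x s) y 1].

Context (M : mesh R).

Definition curl (a : vfield M) : vfield M :=
  ((fun K => dy (a.2 K), fun K x y => - dx (a.2 K) x y),
   fun K x y => dx (a.1.2 K) x y - dy (a.1.1 K) x y).

Definition div2 (r : bfield M * bfield M) : bfield M :=
  fun K x y => dx (r.1 K) x y + dy (r.2 K) x y.

Definition divfree (r : bfield M * bfield M) : Prop :=
  forall K x y, cell K (x, y) -> div2 r K x y = 0.

Definition cross (a b : vfield M) : vfield M :=
  ((fun K x y => a.1.2 K x y * b.2 K x y - a.2 K x y * b.1.2 K x y,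
    fun K x y => a.2 K x y * b.1.1 K x y - a.1.1 K x y * b.2 K x y),
   fun K x y => a.1.1 K x y * b.1.2 K x y - a.1.2 K x y * b.1.1 K x y).

Definition dot (a b : vfield M) : bfield M :=
  fun K x y =>
    a.1.1 K x y * b.1.1 K x y + a.1.2 K x y * b.1.2 K x y
    + a.2 K x y * b.2 K x y.

Definition vopp (a : vfield M) : vfield M :=
  ((fun K x y => - a.1.1 K x y, fun K x y => - a.1.2 K x y),
   fun K x y => - a.2 K x y).

Definition vstep (n : nat) (B : vfield M) (tau : R) (P : pred 'I_n)
    (c : 'I_n -> R) (F : 'I_n -> vfield M) : vfield M :=
  ((fun K x y => B.1.1 K x y - tau * \sum_(j | P j) c j * (F j).1.1 K x y,
    fun K x y => B.1.2 K x y - tau * \sum_(j | P j) c j * (F j).1.2 K x y),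
   fun K x y => B.2 K x y - tau * \sum_(j | P j) c j * (F j).2 K x y).

End differential_operators.

Section spaces.
Context {R : realType} (M : mesh R).

Notation mu2 := (@lebesgue_measure R \x @lebesgue_measure R)%E.

Definition L2 (w : R * R -> R) : Prop := (w \_ (dom M)) \in Lfun mu2 2%:E.

Definition test_function (phi : R -> R -> R) : Prop :=
  [/\ smooth phi,
      forall x y, phi (x + (mx1 M - mx0 M)) y = phi x y
    & forall x y, phi x (y + (my1 M - my0 M)) = phi x y].

Definition pair_broken (f : bfield M) (phi : R -> R -> R) : R :=
  \sum_K \int[mu2]_(z in cell K) (f K z.1 z.2 * phi z.1 z.2).

Definition pair_global (w : R * R -> R) (phi : R -> R -> R) : R :=
  \int[mu2]_(z in dom M) (w z * phi z.1 z.2).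

(* Weak differentiability on the torus, with weak derivatives in L2(Omega).
   These predicates are only used for piecewise polynomial fields, which are
   themselves square integrable. *)
Definition H1 (f : bfield M) : Prop :=
  exists gx gy : R * R -> R, [/\ L2 gx, L2 gy &
    forall phi, test_function phi ->
      pair_broken f (dx phi) = - pair_global gx phi /\
      pair_broken f (dy phi) = - pair_global gy phi].

Definition Hcurl (g : bfield M * bfield M) : Prop :=
  exists w : R * R -> R, L2 w /\
    forall phi, test_function phi ->
      pair_broken g.2 (dx phi) - pair_broken g.1 (dy phi)
      = - pair_global w phi.

Definition Hdiv (r : bfield M * bfield M) : Prop :=
  exists w : R * R -> R, L2 w /\
    forall phi, test_function phi ->
      pair_broken r.1 (dx phi) + pair_broken r.2 (dy phi)
      = - pair_global w phi.

Definition Qpoly (a b : nat) (f : R -> R -> R) : Prop :=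
  exists c : 'M[R]_(a.+1, b.+1), forall x y,
    f x y = \sum_(i < a.+1) \sum_(j < b.+1) c i j * x ^+ i * y ^+ j.

Definition bQ (a b : nat) (f : bfield M) : Prop := forall K, Qpoly a b (f K).

Definition Vh (k : nat) (v : bfield M) : Prop := bQ k k v.

Definition Wh (k : nat) (w : bfield M) : Prop := bQ k k w /\ H1 w.

Definition Nh (k : nat) (g : bfield M * bfield M) : Prop :=
  [/\ bQ k k.+1 g.1, bQ k.+1 k g.2 & Hcurl g].

Definition Rh (k : nat) (r : bfield M * bfield M) : Prop :=
  [/\ bQ k.+1 k r.1, bQ k k.+1 r.2 & Hdiv r].

Definition Xh (p : nat) (u : vfield M) : Prop :=
  [/\ Vh p u.1.1, Vh p u.1.2 & Vh p u.2].

Definition Bh (m : nat) (B : vfield M) : Prop := Rh m B.1 /\ Vh m B.2.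

Definition Ah (m : nat) (A : vfield M) : Prop := Nh m A.1 /\ Wh m.+1 A.2.

Definition int_broken (f : bfield M) : R :=
  \sum_K \int[mu2]_(z in cell K) f K z.1 z.2.

End spaces.

Section quadrature.
Context {R : realType}.

(* A rule with r + 1 points on [-1, 1]. *)
Record quad (r : nat) := Quad { node : 'I_r.+1 -> R; wgt : 'I_r.+1 -> R }.

(* Legendre polynomials, by Rodrigues' formula. *)
Definition legendre (n : nat) : {poly R} :=
  ((2 ^ n * n`!)%N%:R)^-1 *: (('X^2 - 1) ^+ n)^`(n).

(* Each weight is the integral of the corresponding Lagrange basis function. *)
Definition interpolatory r (q : quad r) : Prop := forall i,
  wgt q i = \int[@lebesgue_measure R]_(s in `[-1, 1]%classic)
    \prod_(j | j != i) ((s - node q j) / (node q i - node q j)).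

Definition increasing_nodes r (q : quad r) : Prop :=
  forall i j : 'I_r.+1, (i < j)%N -> node q i < node q j.

Definition is_gauss r (q : quad r) : Prop :=
  [/\ increasing_nodes q, forall i, root (legendre r.+1) (node q i)
    & interpolatory q].

(* The nodes are -1, 1 and the zeros of the derivative of the Legendre
   polynomial of degree r, i.e. the r + 1 roots of (1 - X^2) P_r'. *)
Definition is_gll r (q : quad r) : Prop :=
  [/\ increasing_nodes q,
      forall i, root ((1 - 'X^2) * (legendre r)^`()) (node q i)
    & interpolatory q].

Definition tensor (M : mesh R) r s (qx : quad r) (qy : quad s)
    (f : bfield M) : R :=
  \sum_K jac K * \sum_i \sum_j
    wgt qx i * wgt qy j * f K (Fx K (node qx i)) (Fy K (node qy j)).

(* GLL and Gauss rules, and, for each of the three components of the (.,.)_B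
   product, the sizes (number of points minus 1) of the Gauss rules used in x
   and in y. *)
Record rules := Rules {
  gll : forall r, quad r;
  gau : forall r, quad r;
  degBx : nat * nat; degBy : nat * nat; degBz : nat * nat }.

Context (M : mesh R) (Q : rules).

Definition quadV (p : nat) (f : bfield M) : R := tensor (gll Q p) (gll Q p) f.

Definition ipV (p : nat) (f g : bfield M) : R :=
  quadV p (fun K x y => f K x y * g K x y).

Definition scale (rho : bfield M) (v : bfield M) : bfield M :=
  fun K x y => rho K x y * v K x y.

Definition ipX (p : nat) (rho : bfield M) (v z : vfield M) : R :=
  ipV p (scale rho v.1.1) z.1.1 + ipV p (scale rho v.1.2) z.1.2
  + ipV p (scale rho v.2) z.2.

Definition ipA (m : nat) (F G : vfield M) : R :=
  tensor (gau Q m) (gll Q m.+1) (fun K x y => F.1.1 K x y * G.1.1 K x y)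
  + tensor (gll Q m.+1) (gau Q m) (fun K x y => F.1.2 K x y * G.1.2 K x y)
  + tensor (gll Q m.+1) (gll Q m.+1) (fun K x y => F.2 K x y * G.2 K x y).

Definition ipB (C D : vfield M) : R :=
  tensor (gau Q (degBx Q).1) (gau Q (degBx Q).2)
    (fun K x y => C.1.1 K x y * D.1.1 K x y)
  + tensor (gau Q (degBy Q).1) (gau Q (degBy Q).2)
    (fun K x y => C.1.2 K x y * D.1.2 K x y)
  + tensor (gau Q (degBz Q).1) (gau Q (degBz Q).2)
    (fun K x y => C.2 K x y * D.2 K x y).

Definition formC (m : nat) (v B G : vfield M) : R :=
  ipA m (vopp (cross v B)) G.

Definition admissible (m : nat) : Prop :=
  [/\ forall r, (0 < r)%N -> is_gll (gll Q r),
      forall r, is_gauss (gau Q r)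
    & forall C D : vfield M, Bh m C -> Bh m D ->
        ipB C D = int_broken (dot C D)].

Definition positive_nodal (p : nat) (rho : bfield M) : Prop :=
  forall K (i j : 'I_p.+1),
    0 < rho K (Fx K (node (gll Q p) i)) (Fy K (node (gll Q p) j)).

End quadrature.

Section system.
Context {R : realType} (M : mesh R) (Q : rules (R := R)) (p m : nat).
Context (rho eta : bfield M).

Definition reconstructed (u B J E : vfield M) : Prop :=
  [/\ Ah m J, Ah m E,
      forall chi : vfield M, Ah m chi ->
        ipA Q m J chi - ipB Q B (curl chi) = 0
    & forall G : vfield M, Ah m G ->
        ipA Q m E G - formC Q m u B G
        - ipV Q p (scale eta (dot J G)) (fun _ _ _ => 1) = 0].

Definition dt (f : R -> bfield M) (t : R) : bfield M :=
  fun K x y => derive1 (fun s => f s K x y) t.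

Definition vdt (B : R -> vfield M) (t : R) : vfield M :=
  ((dt (fun s => (B s).1.1) t, dt (fun s => (B s).1.2) t),
   dt (fun s => (B s).2) t).

Definition time_regular (T : R) (f : R -> bfield M) : Prop :=
  forall K x y,
    {within `[0, T]%classic, continuous (fun s => f s K x y)} /\
    forall t, 0 < t < T -> derivable (fun s => f s K x y) t 1.

Definition vtime_regular (T : R) (F : R -> vfield M) : Prop :=
  [/\ time_regular T (fun t => (F t).1.1), time_regular T (fun t => (F t).1.2)
    & time_regular T (fun t => (F t).2)].

(* The algebraic equations hold on [0, T]; the evolution equations hold in
   ]0, T[, the evolving fields being continuous up to the end points. *)
Definition semidiscrete_solution (T : R)
    (u B : R -> vfield M) (e : R -> bfield M) (J E : R -> vfield M) : Prop :=
  [/\ vtime_regular T u, vtime_regular T B, time_regular T e,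
      forall t, 0 <= t <= T ->
        [/\ Xh p (u t), Bh m (B t), Vh p (e t)
          & reconstructed (u t) (B t) (J t) (E t)]
    & forall t, 0 < t < T ->
        [/\ forall v : vfield M, Xh p v ->
              ipX Q p rho (vdt u t) v - formC Q m v (B t) (J t) = 0,
            forall C : vfield M, Bh m C ->
              ipB Q (vdt B t) C + ipB Q (curl (E t)) C = 0
          & forall v : bfield M, Vh p v ->
              ipV Q p (scale rho (dt e t)) v
              - ipV Q p (scale eta (dot (J t) (J t))) v = 0]].

(* One step of the explicit Runge-Kutta method with s stages and coefficients
   (a, b), from (u0, B0, e0) to (u1, B1, e1), with stage values us, Bs, es, Js,
   Es.  Only the a i j with j < i are used. *)
Definition rk_step (s : nat) (a : 'I_s -> 'I_s -> R) (b : 'I_s -> R) (tau : R)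
    (u0 B0 : vfield M) (e0 : bfield M)
    (us Bs : 'I_s -> vfield M) (es : 'I_s -> bfield M) (Js Es : 'I_s -> vfield M)
    (u1 B1 : vfield M) (e1 : bfield M) : Prop :=
  let curlEs := fun j => curl (Es j) in
  [/\ forall i, [/\ Xh p (us i), Vh p (es i)
                  & reconstructed (us i) (Bs i) (Js i) (Es i)],
      forall i, Bs i = vstep B0 tau (fun j => (j < i)%N) (a i) curlEs,
      B1 = vstep B0 tau xpredT b curlEs,
      [/\ Xh p u1,
          forall i (v : vfield M), Xh p v ->
            ipX Q p rho (us i) v = ipX Q p rho u0 v
              + tau * \sum_(j < s | (j < i)%N) a i j * formC Q m v (Bs j) (Js j)
        & forall v : vfield M, Xh p v ->
            ipX Q p rho u1 v = ipX Q p rho u0 v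
              + tau * \sum_(j < s) b j * formC Q m v (Bs j) (Js j)]
    & [/\ Vh p e1,
          forall i (v : bfield M), Vh p v ->
            ipV Q p (scale rho (es i)) v = ipV Q p (scale rho e0) v
              + tau * \sum_(j < s | (j < i)%N)
                  a i j * ipV Q p (scale eta (dot (Js j) (Js j))) v
        & forall v : bfield M, Vh p v ->
            ipV Q p (scale rho e1) v = ipV Q p (scale rho e0) v
              + tau * \sum_(j < s)
                  b j * ipV Q p (scale eta (dot (Js j) (Js j))) v]].

End system.

(* Main.v *)
(* The weak form of Faraday's law gives d/dt B = - curl E pointwise once curl
   maps A_h into B_h, and curl fields are divergence-free.  Instead of showing
   that d/dt B stays in B_h, represent the functional B |-> (div B)(x, y) on the
   finite-dimensional space B_h as (B, C)_B for some C in B_h; then (div B)(x, y)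
   has derivative - (curl E, C)_B = - (div curl E)(x, y) = 0.
   That the in-plane curl of a potential A_z in H^1 lies in H(div), with zero
   weak divergence, follows from dx dy = dy dx on test functions as soon as the
   L^2 weak derivatives of A_z act like the elementwise ones.  This is obtained
   without traces: multiply a test function by 1 - (1 - theta)^n, where theta is
   a periodic product of squared sines vanishing on the mesh lines, integrate by
   parts on each element, and let n tend to infinity by dominated convergence. *)

Require Import Defs.
From HB Require Import structures.
From mathcomp Require Import all_boot all_order all_algebra.
From mathcomp Require Import all_classical all_reals all_analysis.
From mathcomp Require Import measurable_realfun ring lra.
Set Implicit Arguments.
Unset Strict Implicit.
Unset Printing Implicit Defensive.
Import Order.TTheory GRing.Theory Num.Theory.
Import numFieldNormedType.Exports.
Local Open Scope classical_set_scope.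
Local Open Scope ring_scope.

(** * Smooth functions of two variables *)

Section smooth_functions.
Context {R : realType}.
Implicit Types f g h : R -> R -> R.

(** Faraday's law is tested only against fields of [Bh], and exactness of the quadrature speaks only
    of pairs in [Bh], so it cannot be applied to the pointwise time derivative [vdt B]. The time
    argument therefore treats [ipB] as a finite sum of point values. Exactness enters only for
    fields of [Bh], to show that null vectors of [ipB] have zero divergence on every cell; this is
    enough for a representing field to exist even if the form is degenerate. The cut-off is a
    polynomial in theta, so no root or quotient endangers its smoothness, and theta is built from
    sines because test functions have to be smooth and periodic on the whole plane. Derivatives of
    the cut-off are never estimated: the weak identity and the elementwise integration by parts
    differentiate the same product, and comparing them leaves the cut-off undifferentiated before
    the limit is taken. The Runge-Kutta increments are curls of fields of [Ah] by construction, so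
    in that case linearity suffices. *)

Definition plane f (z : R * R) : R := f z.1 z.2.

(** [smooth] quantifies over all iterated partial derivatives, so a direct proof for a product would
    need a Leibniz formula for words. Here a class of C1 functions is generated that is closed under
    [dx] and [dy]; smoothness of its members then follows by induction on the word. One sine
    constructor per variable suffices because the cosine is a sine shifted by pi / 2. *)
Inductive algebra_of_smooth : (R -> R -> R) -> Prop :=
| Asmooth f of smooth f : algebra_of_smooth f
| Acst c : algebra_of_smooth (fun _ _ => c)
| Ax : algebra_of_smooth (fun x _ => x)
| Ay : algebra_of_smooth (fun _ y => y)
| Asinx a b : algebra_of_smooth (fun x _ => sin (a * x + b))
| Asiny a b : algebra_of_smooth (fun _ y => sin (a * y + b))
| Aadd f g of algebra_of_smooth f & algebra_of_smooth g :
    algebra_of_smooth (fun x y => f x y + g x y)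
| Amul f g of algebra_of_smooth f & algebra_of_smooth g :
    algebra_of_smooth (fun x y => f x y * g x y).

Lemma smooth_continuous f : smooth f -> continuous (plane f).
Proof. by move=> /(_ [::]) []. Qed.

Lemma smooth_derivablex f (x y : R) : smooth f -> derivable (f ^~ y) x 1.
Proof. by move=> /(_ [::]) []. Qed.

Lemma smooth_derivabley f (x y : R) : smooth f -> derivable (f x) y 1.
Proof. by move=> /(_ [::]) []. Qed.

Lemma smooth_dx f : smooth f -> smooth (dx f).
Proof.
by move=> sf w; move: (sf (rcons w true)); rewrite /partials -cats1 foldr_cat.
Qed.

Lemma smooth_dy f : smooth f -> smooth (dy f).
Proof.
by move=> sf w; move: (sf (rcons w false)); rewrite /partials -cats1 foldr_cat.
Qed.

Lemma is_derive_dx f (x y : R) : derivable (f ^~ y) x 1 ->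
  is_derive x 1 (f ^~ y) (dx f x y).
Proof. by move=> d; apply: DeriveDef => //; rewrite /dx derive1E. Qed.

Lemma is_derive_dy f (x y : R) : derivable (f x) y 1 ->
  is_derive y 1 (f x) (dy f x y).
Proof. by move=> d; apply: DeriveDef => //; rewrite /dy derive1E. Qed.

Lemma dx_eq f (x y d : R) : is_derive x 1 (f ^~ y) d -> dx f x y = d.
Proof. by move=> H; rewrite /dx derive1E derive_val. Qed.

Lemma dy_eq f (x y d : R) : is_derive y 1 (f x) d -> dy f x y = d.
Proof. by move=> H; rewrite /dy derive1E derive_val. Qed.

Lemma is_derive_sin_affine (a b x : R) :
  is_derive x 1 (fun s => sin (a * s + b)) (a * sin (a * x + (b + pi / 2))).
Proof.
have H : is_derive x 1 (fun s => a * s + b) a.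
  by apply: is_derive_eq; rewrite addr0 /GRing.scale /= mulr1.
rewrite addrA sinDpihalf mulrC.
exact: (is_derive1_comp (g := fun s => a * s + b)).
Qed.

Let der f := forall x y : R, [/\ derivable (f ^~ y) x 1 & derivable (f x) y 1].

Lemma dxD f g : der f -> der g ->
  dx (fun x y => f x y + g x y) = fun x y => dx f x y + dx g x y.
Proof.
move=> df dg; apply/funext => x; apply/funext => y; apply: dx_eq.
have [/is_derive_dx ? _] := df x y; have [/is_derive_dx ? _] := dg x y.
exact: is_deriveD.
Qed.

Lemma dyD f g : der f -> der g ->
  dy (fun x y => f x y + g x y) = fun x y => dy f x y + dy g x y.
Proof.
move=> df dg; apply/funext => x; apply/funext => y; apply: dy_eq.
have [_ /is_derive_dy ?] := df x y; have [_ /is_derive_dy ?] := dg x y.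
exact: is_deriveD.
Qed.

Lemma dxM f g : der f -> der g ->
  dx (fun x y => f x y * g x y) = fun x y => dx f x y * g x y + f x y * dx g x y.
Proof.
move=> df dg; apply/funext => x; apply/funext => y; apply: dx_eq.
have [/is_derive_dx Hf _] := df x y; have [/is_derive_dx Hg _] := dg x y.
by apply: is_derive_eq (is_deriveM Hf Hg) _; rewrite /GRing.scale /=; ring.
Qed.

Lemma dyM f g : der f -> der g ->
  dy (fun x y => f x y * g x y) = fun x y => dy f x y * g x y + f x y * dy g x y.
Proof.
move=> df dg; apply/funext => x; apply/funext => y; apply: dy_eq.
have [_ /is_derive_dy Hf] := df x y; have [_ /is_derive_dy Hg] := dg x y.
by apply: is_derive_eq (is_deriveM Hf Hg) _; rewrite /GRing.scale /=; ring.
Qed.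

Lemma algebra_of_smooth_C1 f : algebra_of_smooth f ->
  [/\ continuous (plane f), der f, algebra_of_smooth (dx f)
    & algebra_of_smooth (dy f)].
Proof.
have A0 : algebra_of_smooth (fun _ _ => 0) by exact: Acst.
have A1 : algebra_of_smooth (fun _ _ => 1) by exact: Acst.
have dxE (f1 g : R -> R -> R) :
  (forall x y : R, is_derive x 1 (f1 ^~ y) (g x y)) -> dx f1 = g.
  by move=> H; apply/funext => x; apply/funext => y; exact: dx_eq.
have dyE (f1 g : R -> R -> R) :
  (forall x y : R, is_derive y 1 (f1 x) (g x y)) -> dy f1 = g.
  by move=> H; apply/funext => x; apply/funext => y; exact: dy_eq.
elim=> {f} [f sf|c|||a b|a b|f g _ [cf df fx fy] _ [cg dg gx gy]|
  f g Af [cf df fx fy] Ag [cg dg gx gy]].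
- split; first exact: smooth_continuous.
  + by move=> x y; split; [exact: smooth_derivablex|exact: smooth_derivabley].
  + exact/Asmooth/smooth_dx.
  + exact/Asmooth/smooth_dy.
- split; first exact: cst_continuous.
  + by move=> x y; split; exact: derivable_cst.
  + by rewrite (dxE _ (fun _ _ => 0) (fun _ _ => is_derive_cst _ _ _)).
  + by rewrite (dyE _ (fun _ _ => 0) (fun _ _ => is_derive_cst _ _ _)).
- split; first by move=> z; exact: cvg_fst.
  + by move=> x y; split; [exact: derivable_id|exact: derivable_cst].
  + by rewrite (dxE _ (fun _ _ => 1) (fun _ _ => is_derive_id _ _)).
  + by rewrite (dyE _ (fun _ _ => 0) (fun _ _ => is_derive_cst _ _ _)).
- split; first by move=> z; exact: cvg_snd.
  + by move=> x y; split; [exact: derivable_cst|exact: derivable_id].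
  + by rewrite (dxE _ (fun _ _ => 0) (fun _ _ => is_derive_cst _ _ _)).
  + by rewrite (dyE _ (fun _ _ => 1) (fun _ _ => is_derive_id _ _)).
- split.
  + move=> z; rewrite /plane /=.
    apply: (continuous_comp (f := fun z : R * R => a * z.1 + b));
      last exact: continuous_sin.
    apply: cvgD; last exact: cvg_cst.
    by apply: cvgM; [exact: cvg_cst|exact: cvg_fst].
  + move=> x y; split; last exact: derivable_cst.
    by have [] := is_derive_sin_affine a b x.
  + rewrite (dxE _ (fun x _ => a * sin (a * x + (b + pi / 2)))
      (fun x y => is_derive_sin_affine a b x)).
    by apply: (Amul (f := fun _ _ => a)); [exact: Acst|exact: Asinx].
  + by rewrite (dyE _ (fun _ _ => 0) (fun _ _ => is_derive_cst _ _ _)).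
- split.
  + move=> z; rewrite /plane /=.
    apply: (continuous_comp (f := fun z : R * R => a * z.2 + b));
      last exact: continuous_sin.
    apply: cvgD; last exact: cvg_cst.
    by apply: cvgM; [exact: cvg_cst|exact: cvg_snd].
  + move=> x y; split; first exact: derivable_cst.
    by have [] := is_derive_sin_affine a b y.
  + by rewrite (dxE _ (fun _ _ => 0) (fun _ _ => is_derive_cst _ _ _)).
  + rewrite (dyE _ (fun _ y => a * sin (a * y + (b + pi / 2)))
      (fun x y => is_derive_sin_affine a b y)).
    by apply: (Amul (f := fun _ _ => a)); [exact: Acst|exact: Asiny].
- split.
  + by move=> z; apply: cvgD; [exact: cf|exact: cg].
  + move=> x y; have [? ?] := df x y; have [? ?] := dg x y.
    by split; exact: derivableD.
  + by rewrite dxD//; exact: Aadd.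
  + by rewrite dyD//; exact: Aadd.
- split.
  + by move=> z; apply: cvgM; [exact: cf|exact: cg].
  + move=> x y; have [? ?] := df x y; have [? ?] := dg x y.
    have Hx : is_derive x 1 (fun s => f s y * g s y)
        (f x y *: dx g x y + g x y *: dx f x y).
      by apply: is_deriveM; exact: is_derive_dx.
    have Hy : is_derive y 1 (fun t => f x t * g x t)
        (f x y *: dy g x y + g x y *: dy f x y).
      by apply: is_deriveM; exact: is_derive_dy.
    by split;
      [exact: (@ex_derive _ _ _ _ _ _ _ Hx)|exact: (@ex_derive _ _ _ _ _ _ _ Hy)].
  + by rewrite dxM//; apply: Aadd; exact: Amul.
  + by rewrite dyM//; apply: Aadd; exact: Amul.
Qed.

Lemma smooth_algebra f : algebra_of_smooth f -> smooth f.
Proof.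
move=> Af w; have : algebra_of_smooth (partials w f).
  elim: w => [//|[] w IHw]; first by have [] := algebra_of_smooth_C1 IHw.
  by have [] := algebra_of_smooth_C1 IHw.
move=> /algebra_of_smooth_C1 [cf df _ _].
by split=> // x y; have [] := df x y.
Qed.

Lemma smoothD f g : smooth f -> smooth g -> smooth (fun x y => f x y + g x y).
Proof. by move=> sf sg; apply/smooth_algebra/Aadd; exact: Asmooth. Qed.

Lemma smoothM f g : smooth f -> smooth g -> smooth (fun x y => f x y * g x y).
Proof. by move=> sf sg; apply/smooth_algebra/Amul; exact: Asmooth. Qed.

Lemma smooth_cst c : smooth (fun _ _ : R => c).
Proof. exact/smooth_algebra/Acst. Qed.

Lemma smoothN f : smooth f -> smooth (fun x y => - f x y).
Proof.
move=> sf; have := smoothM (smooth_cst (-1)) sf; congr smooth.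
by apply/funext => x; apply/funext => y; rewrite mulN1r.
Qed.

Lemma smoothX f n : smooth f -> smooth (fun x y => f x y ^+ n).
Proof.
move=> sf; elim: n => [|n IHn]; first exact: smooth_cst.
have := smoothM sf IHn; congr smooth.
by apply/funext => x; apply/funext => y; rewrite exprS.
Qed.

Lemma smooth_sum (I : Type) (s : seq I) (P : pred I) (F : I -> R -> R -> R) :
  (forall i, smooth (F i)) -> smooth (fun x y => \sum_(i <- s | P i) F i x y).
Proof.
move=> sF; elim: s => [|i s IHs].
  rewrite (_ : (fun _ _ => _) = fun _ _ => 0); first exact: smooth_cst.
  by apply/funext => x; apply/funext => y; rewrite big_nil.
have [Pi|Pi] := boolP (P i).
  have := smoothD (sF i) IHs; congr smooth.
  by apply/funext => x; apply/funext => y; rewrite big_cons Pi.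
move: IHs; congr smooth.
by apply/funext => x; apply/funext => y; rewrite big_cons (negbTE Pi).
Qed.

Lemma smooth_prod (I : Type) (s : seq I) (F : I -> R -> R -> R) :
  (forall i, smooth (F i)) -> smooth (fun x y => \prod_(i <- s) F i x y).
Proof.
move=> sF; elim: s => [|i s IHs].
  rewrite (_ : (fun _ _ => _) = fun _ _ => 1); first exact: smooth_cst.
  by apply/funext => x; apply/funext => y; rewrite big_nil.
have := smoothM (sF i) IHs; congr smooth.
by apply/funext => x; apply/funext => y; rewrite big_cons.
Qed.

Lemma Qpoly_smooth a b f : Qpoly a b f -> smooth f.
Proof.
move=> [c fE]; rewrite (_ : f = fun x y =>
    \sum_(i < a.+1) \sum_(j < b.+1) c i j * x ^+ i * y ^+ j); last first.
  by apply/funext => x; apply/funext => y.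
apply: smooth_sum => i; apply: smooth_sum => j.
apply: (smoothM (f := fun x y => c i j * x ^+ i)); last first.
  by apply: (smoothX (f := fun _ y => y)); exact/smooth_algebra/Ay.
apply: (smoothM (f := fun _ _ => c i j)); first exact: smooth_cst.
by apply: (smoothX (f := fun x _ => x)); exact/smooth_algebra/Ax.
Qed.

Lemma smooth_der f : smooth f -> der f.
Proof.
by move=> sf x y; split; [exact: smooth_derivablex|exact: smooth_derivabley].
Qed.

Lemma smooth_continuousx f y : smooth f -> continuous (f ^~ y).
Proof.
move=> sf x.
exact/differentiable_continuous/derivable1_diffP/smooth_derivablex.
Qed.

Lemma smooth_continuousy f x : smooth f -> continuous (f x).
Proof.
move=> sf y.
exact/differentiable_continuous/derivable1_diffP/smooth_derivabley.
Qed.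

Lemma MVT_step (F dF : R -> R) (x h : R) : (forall s : R, is_derive s 1 F (dF s)) ->
  0 < h -> exists2 c, x < c < x + h & F (x + h) - F x = dF c * h.
Proof.
move=> dFE h0; have /MVT := ltr_pwDr h0 (lexx x).
move=> /(_ F dF) [|c].
- apply: continuous_subspaceT => z.
  by apply/differentiable_continuous/derivable1_diffP; case: (dFE z).
- by rewrite in_itv /= => cI ->; exists c => //; rewrite addrAC subrr add0r.
Qed.

(* The second difference over a small square equals h^2 times either mixed
   derivative, each evaluated at some point of the square. *)
Lemma dx_dyC f (x y : R) : smooth f -> dx (dy f) x y = dy (dx f) x y.
Proof.
have close (A B C D : R) : D = C -> `|B - D| < `|A - B| / 2 ->
    `|A - C| < `|A - B| / 2 -> False.
  move=> ->; have := ler_distD C A B; rewrite (distrC B C); lra.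
move=> sf; apply/eqP; rewrite -subr_eq0; apply/negPn/negP => ne.
set e := `|dx (dy f) x y - dy (dx f) x y|.
have e0 : 0 < e / 2 by rewrite divr_gt0// normr_gt0.
have sxy := smooth_dx (smooth_dy sf); have syx := smooth_dy (smooth_dx sf).
have /cvgrPdist_lt/(_ _ e0) : {for (x, y), continuous (plane (dx (dy f)))}.
  by move: (x, y); exact: smooth_continuous.
have /cvgrPdist_lt/(_ _ e0) : {for (x, y), continuous (plane (dy (dx f)))}.
  by move: (x, y); exact: smooth_continuous.
move=> /nbhs_ballP[d1 /= d10 Hd1] /nbhs_ballP[d2 /= d20 Hd2].
pose h := Num.min d1 d2 / 2.
have m0 : 0 < Num.min d1 d2 by rewrite lt_min d10.
have h0 : 0 < h by rewrite divr_gt0.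
have hm : h < Num.min d1 d2 by rewrite /h; lra.
have [hd1 hd2] : h < d1 /\ h < d2 by move: hm; rewrite lt_min => /andP.
have nearby (c z : R) : z < c < z + h -> `|c - z| < h.
  by move=> /andP[? ?]; rewrite gtr0_norm; lra.
have [c1 c1I E1] : exists2 c, x < c < x + h &
    f (x + h) (y + h) - f (x + h) y - (f x (y + h) - f x y)
    = (dx f c (y + h) - dx f c y) * h.
  apply: (MVT_step (F := fun s => f s (y + h) - f s y)
    (dF := fun s => dx f s (y + h) - dx f s y)) => // s.
  by apply: is_deriveB; exact/is_derive_dx/smooth_derivablex.
have [c2 c2I E2] : exists2 c, y < c < y + h &
    f (x + h) (y + h) - f x (y + h) - (f (x + h) y - f x y)
    = (dy f (x + h) c - dy f x c) * h.
  apply: (MVT_step (F := fun t => f (x + h) t - f x t)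
    (dF := fun t => dy f (x + h) t - dy f x t)) => // t.
  by apply: is_deriveB; exact/is_derive_dy/smooth_derivabley.
have [c3 c3I E3] : exists2 c, y < c < y + h &
    dx f c1 (y + h) - dx f c1 y = dy (dx f) c1 c * h.
  apply: MVT_step (_ : forall t : R, is_derive t 1 (dx f c1) (dy (dx f) c1 t)) h0 => t.
  exact/is_derive_dy/smooth_derivabley/smooth_dx.
have [c4 c4I E4] : exists2 c, x < c < x + h &
    dy f (x + h) c2 - dy f x c2 = dx (dy f) c c2 * h.
  apply: MVT_step
    (_ : forall s : R, is_derive s 1 (dy f ^~ c2) (dx (dy f) s c2)) h0 => s.
  exact/is_derive_dx/smooth_derivablex/smooth_dy.
have aux (A B C D P1 P2 Q1 Q2 : R) : A - B - (C - D) = P1 * h ->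
    A - C - (B - D) = P2 * h -> P1 = Q1 * h -> P2 = Q2 * h -> Q1 = Q2.
  move=> H1 H2 H3 H4; apply/(mulIf (lt0r_neq0 h0))/(mulIf (lt0r_neq0 h0)).
  by rewrite -H3 -H4 -H1 -H2; ring.
have E : dy (dx f) c1 c3 = dx (dy f) c4 c2 := aux _ _ _ _ _ _ _ _ E1 E2 E3 E4.
have H1 : `|dy (dx f) x y - dy (dx f) c1 c3| < e / 2.
  apply: (Hd1 (c1, c3)); split; rewrite /ball /= distrC.
    exact: lt_trans (nearby _ _ c1I) hd1.
  exact: lt_trans (nearby _ _ c3I) hd1.
have H2 : `|dx (dy f) x y - dx (dy f) c4 c2| < e / 2.
  apply: (Hd2 (c4, c2)); split; rewrite /ball /= distrC.
    exact: lt_trans (nearby _ _ c4I) hd2.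
  exact: lt_trans (nearby _ _ c2I) hd2.
exact: close E H1 H2.
Qed.

End smooth_functions.

(** * Integration over boxes *)

Section plane_integration.
Context {R : realType}.

Notation mu := (@lebesgue_measure R).
Notation mu2 := (@lebesgue_measure R \x @lebesgue_measure R)%E.

Definition box (a b c d : R) : set (R * R) := `[a, b]%classic `*` `[c, d]%classic.

Lemma measurable_box a b c d : measurable (box a b c d).
Proof. by apply: measurableX; exact: measurable_itv. Qed.

(** Measurability in the plane refers to the product sigma-algebra, so openness is turned into a
    countable union of rectangles with rational corners. The union runs over all rational
    quadruples, those whose rectangle leaves [O] contributing the empty set. *)
Lemma open_measurable_plane (O : set (R * R)) : open O -> measurable O.
Proof.
move=> oO.
pose rect (r : rat * rat * rat * rat) : set (R * R) :=
  `]ratr r.1.1.1, ratr r.1.1.2[%classic `*` `]ratr r.1.2, ratr r.2[%classic.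
have -> : O = \bigcup_r (if `[< rect r `<=` O >] then rect r else set0).
  apply/seteqP; split=> [[x y] Oxy|z [r _]]; last by case: asboolP => [rO /rO|_].
  have /nbhs_ballP[e /= e0 He] := open_nbhs_nbhs (conj oO Oxy).
  have between (u v : R) : u < v -> exists q, u < ratr q < v.
    by move=> /rat_in_itvoo[q]; rewrite in_itv; exists q.
  have [q1 /andP[? ?]] : exists q, x - e < ratr q < x by apply: between; lra.
  have [q2 /andP[? ?]] : exists q, x < ratr q < x + e by apply: between; lra.
  have [q3 /andP[? ?]] : exists q, y - e < ratr q < y by apply: between; lra.
  have [q4 /andP[? ?]] : exists q, y < ratr q < y + e by apply: between; lra.
  exists (q1, q2, q3, q4) => //; case: asboolP => [_|]; last first.
    case=> -[s t] [] /=; rewrite !in_itv /= => /andP[? ?] /andP[? ?].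
    by apply: He; split; rewrite /ball /= ltr_norml; apply/andP; split; lra.
  by split; rewrite /= in_itv /=; apply/andP.
apply: countable_bigcupT_measurable; first exact: countableP.
move=> r; case: asboolP => // _.
by apply: measurableX; exact: measurable_itv.
Qed.

Lemma continuous_measurable_plane (f : R * R -> R) D :
  continuous f -> measurable_fun D f.
Proof.
move=> cf; apply: measurable_funTS.
apply: (measurability _ (RGenOpens.measurableE R)) => _ [_ [a [b ->] <-]].
rewrite setTI; apply: open_measurable_plane.
by apply: open_comp => [z _|]; [exact: cf|exact: interval_open].
Qed.

Lemma mu2_box_lty a b c d : (mu2 (box a b c d) < +oo)%E.
Proof.
rewrite product_measure1E; try exact: measurable_itv.
rewrite /= !lebesgue_measure_itv /=.
by case: ifP; case: ifP; rewrite ?mul0e ?mule0 -?EFinB -?EFinM ?ltry.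
Qed.

Lemma bounded_box (f : R * R -> R) a b c d : continuous f ->
  [bounded f z | z in box a b c d].
Proof.
move=> cf; have cK : compact (box a b c d).
  by apply: compact_setX; exact: segment_compact.
have [M [Mreal HM]] :=
  compact_bounded (continuous_compact (continuous_subspaceT cf) cK).
by exists M; split=> // N MN z Kz; apply: HM MN _ _; exists z.
Qed.

Lemma integrable_box (f : R * R -> R) a b c d : continuous f ->
  mu2.-integrable (box a b c d) (EFin \o f).
Proof.
move=> cf; apply: measurable_bounded_integrable.
- exact: measurable_box.
- exact: mu2_box_lty.
- exact: continuous_measurable_plane.
- exact: bounded_box.
Qed.

(** Fubini on the whole plane for the extension of [f] by zero: slices with [y] outside [[c, d]]
    vanish by extension, the others by assumption. *)
Lemma Rintegral_box_eq0x (f : R * R -> R) a b c d : continuous f ->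
  (forall y, y \in `[c, d] -> (\int[mu]_(x in `[a, b]) (f (x, y))%:E = 0)%E) ->
  \int[mu2]_(z in box a b c d) f z = 0.
Proof.
move=> cf f0; rewrite /Rintegral integral_mkcond -integral21_prod_meas1.
  rewrite integral0_eq// => y _; rewrite /fubini_G.
  have [yI|yI] := pselect (`[c, d]%classic y).
    rewrite -[RHS](f0 y yI) [RHS]integral_mkcond; apply: eq_integral => x _.
    by rewrite !patchE /box; congr (if _ then _ else _); apply/idP/idP;
      rewrite !inE => // -[].
  apply: integral0_eq => x _; rewrite patchE.
  by case: ifPn => //; rewrite inE => -[].
apply/(integrable_mkcond _ _).1; first exact: measurable_box.
exact: integrable_box.
Qed.

Lemma Rintegral_box_eq0y (f : R * R -> R) a b c d : continuous f ->
  (forall x, x \in `[a, b] -> (\int[mu]_(y in `[c, d]) (f (x, y))%:E = 0)%E) ->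
  \int[mu2]_(z in box a b c d) f z = 0.
Proof.
move=> cf f0; rewrite /Rintegral integral_mkcond -integral12_prod_meas1.
  rewrite integral0_eq// => x _; rewrite /fubini_F.
  have [xI|xI] := pselect (`[a, b]%classic x).
    rewrite -[RHS](f0 x xI) [RHS]integral_mkcond; apply: eq_integral => y _.
    by rewrite !patchE /box; congr (if _ then _ else _); apply/idP/idP;
      rewrite !inE => // -[].
  apply: integral0_eq => y _; rewrite patchE.
  by case: ifPn => //; rewrite inE => -[].
apply/(integrable_mkcond _ _).1; first exact: measurable_box.
exact: integrable_box.
Qed.

Lemma FTC2_eq0 (F dF : R -> R) a b : a < b ->
  (forall s : R, is_derive s 1 F (dF s)) -> continuous dF ->
  F a = 0 -> F b = 0 -> (\int[mu]_(s in `[a, b]) (dF s)%:E = 0)%E.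
Proof.
move=> ab HF cdF Fa Fb; have dF' s : derivable F s 1 by case: (HF s).
have cF : continuous F.
  by move=> s; apply/differentiable_continuous/derivable1_diffP.
rewrite (@continuous_FTC2 _ _ F)// ?Fa ?Fb ?subee//.
- exact: continuous_subspaceT.
- split=> [s _|| ]; first exact: dF'.
  + exact/cvg_at_right_filter/cF.
  + exact/cvg_at_left_filter/cF.
- by move=> s _; rewrite derive1E; exact: (@derive_val _ _ _ _ _ _ _ (HF s)).
Qed.

Lemma Rintegral_dx_eq0 (F : R -> R -> R) a b c d : a < b -> smooth F ->
  (forall y, y \in `[c, d] -> F a y = 0 /\ F b y = 0) ->
  \int[mu2]_(z in box a b c d) plane (dx F) z = 0.
Proof.
move=> ab sF F0; apply: Rintegral_box_eq0x.
  exact/smooth_continuous/smooth_dx.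
move=> y /F0[Fa Fb]; apply: (@FTC2_eq0 (F ^~ y)) => //.
- by move=> s; apply: is_derive_dx; exact: smooth_derivablex.
- exact/smooth_continuousx/smooth_dx.
Qed.

Lemma Rintegral_dy_eq0 (F : R -> R -> R) a b c d : c < d -> smooth F ->
  (forall x, x \in `[a, b] -> F x c = 0 /\ F x d = 0) ->
  \int[mu2]_(z in box a b c d) plane (dy F) z = 0.
Proof.
move=> cd sF F0; apply: Rintegral_box_eq0y.
  exact/smooth_continuous/smooth_dy.
move=> x /F0[Fc Fd]; apply: (@FTC2_eq0 (F x)) => //.
- by move=> s; apply: is_derive_dy; exact: smooth_derivabley.
- exact/smooth_continuousy/smooth_dy.
Qed.

Lemma Rintegral_sqr_eq0 (f : R * R -> R) a b c d : a < b -> c < d ->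
  continuous f -> \int[mu2]_(z in box a b c d) (f z ^+ 2) = 0 ->
  forall z, box a b c d z -> f z = 0.
Proof.
move=> ab cd cf int0 [x y] [/=]; rewrite !in_itv /= => /andP[ax xb] /andP[cy yd].
apply/eqP/negPn/negP => fxy.
have cf2 : continuous (fun z => f z ^+ 2).
  rewrite (_ : (fun z => _) = fun z => f z * f z); last first.
    by apply/funext => z; rewrite expr2.
  by move=> z; apply: cvgM; exact: cf.
have : (\int[mu2]_(z in box a b c d) `|(f z ^+ 2)%:E| = 0)%E.
  under eq_integral do rewrite gee0_abs ?lee_fin ?sqr_ge0//.
  apply/eqP; rewrite -fine_eq0; first exact/eqP.
  by apply: integrable_fin_num; [exact: measurable_box|exact: integrable_box].
move=> /(ae_eq_integral_abs _ _ _).1 [||N [mN N0 HN]].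
- exact: measurable_box.
- by apply/measurable_EFinP; exact: continuous_measurable_plane.
have /nbhs_ballP[e /= e0 He] : \forall z \near (x, y), f z != 0.
  exact: (cvgr_neq0 (f (x, y)) (cf (x, y))).
(* The square of radius [e] around the point, cut by the box. Since [a < b] and [c < d] it has
   positive area even when the point lies on an edge or at a corner, yet it is contained in the null
   set [N]. *)
pose a' := Num.max a (x - e); pose b' := Num.min b (x + e).
pose c' := Num.max c (y - e); pose d' := Num.min d (y + e).
have ab' : a' < b' by rewrite /a' /b' lt_min !gt_max; lra.
have cd' : c' < d' by rewrite /c' /d' lt_min !gt_max; lra.
have sub : `]a', b'[%classic `*` `]c', d'[%classic `<=` N.
  move=> [s t] [/=]; rewrite !in_itv /a' /b' /c' /d' /= !gt_max !lt_min.
  move=> /andP[/andP[? ?] /andP[? ?]] /andP[/andP[? ?] /andP[? ?]].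
  apply: HN => /=; apply: contraPnot (_ : f (s, t) != 0).
    move=> H; apply/negP; rewrite negbK -sqrf_eq0; apply/eqP.
    have [] : (f (s, t) ^+ 2)%:E = 0%E :> \bar R; last by [].
    by apply: H; split; rewrite /= in_itv /=; apply/andP; split; lra.
  by apply: He; split; rewrite /ball /= ltr_norml; apply/andP; split; lra.
have : (mu2 (`]a', b'[%classic `*` `]c', d'[%classic) <= 0)%E.
  rewrite -N0; apply: le_measure => //; rewrite inE //.
  by apply: measurableX; exact: measurable_itv.
rewrite product_measure1E; try exact: measurable_itv.
rewrite /= !lebesgue_measure_itv /= !lte_fin ab' cd' -!EFinB -EFinM lee_fin.
by rewrite leNgt mulr_gt0// subr_gt0.
Qed.

(* Integrating [dx (f * dx f)] over the box gives [int (dx f)^2 = 0], so the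
   boundary of the box needs no separate treatment. *)
Lemma smooth_box_eq0 (f : R -> R -> R) a b c d : a < b -> c < d -> smooth f ->
  (forall x y, box a b c d (x, y) -> f x y = 0) ->
  forall x y, box a b c d (x, y) -> dx f x y = 0 /\ dy f x y = 0.
Proof.
move=> ab cd sf f0.
have fI x y : x \in `[a, b] -> y \in `[c, d] -> f x y = 0.
  by move=> xI yI; exact: f0.
have [aI bI] : a \in `[a, b] /\ b \in `[a, b].
  by rewrite !in_itv /= !lexx (ltW ab).
have [cI dI] : c \in `[c, d] /\ d \in `[c, d].
  by rewrite !in_itv /= !lexx (ltW cd).
have [sx sy] := (smooth_dx sf, smooth_dy sf).
move=> x y Kxy; split.
- apply: (Rintegral_sqr_eq0 ab cd (smooth_continuous sx) _ Kxy).
  apply: etrans _ (@Rintegral_dx_eq0 (fun x y => f x y * dx f x y)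
    a b c d ab (smoothM sf sx) _).
  + apply: eq_Rintegral => -[s t]; rewrite inE => Kst.
    rewrite /plane (dxM (smooth_der sf) (smooth_der sx)).
    by rewrite /= (f0 _ _ Kst) mul0r addr0 expr2.
  + by move=> t tI; rewrite !fI// !mul0r.
- apply: (Rintegral_sqr_eq0 ab cd (smooth_continuous sy) _ Kxy).
  apply: etrans _ (@Rintegral_dy_eq0 (fun x y => f x y * dy f x y)
    a b c d cd (smoothM sf sy) _).
  + apply: eq_Rintegral => -[s t]; rewrite inE => Kst.
    rewrite /plane (dyM (smooth_der sf) (smooth_der sy)).
    by rewrite /= (f0 _ _ Kst) mul0r addr0 expr2.
  + by move=> t tI; rewrite !fI// !mul0r.
Qed.

End plane_integration.

(** * Periodic cut-offs vanishing on the mesh lines *)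

Section cutoff.
Context {R : realType}.

Notation mu := (@lebesgue_measure R).
Notation mu2 := (@lebesgue_measure R \x @lebesgue_measure R)%E.

(** The argument is pi (t - z) / L, in the affine form expected by [Asinx] and [Asiny]. For [L > 0]
    the sine changes sign after [L], so its square has period [L]; its zeros are the translates of
    [z] by multiples of [L]. *)
Definition sin2 (L z t : R) : R := sin (pi / L * t + - (pi / L * z)) ^+ 2.

Lemma sin2_ge0 L z t : 0 <= sin2 L z t.
Proof. exact: sqr_ge0. Qed.

Lemma sin2_le1 L z t : sin2 L z t <= 1.
Proof.
by rewrite /sin2 -real_normK ?num_real// exprn_ile1// ler_norml sin_geN1 sin_le1.
Qed.

Lemma sin2_self L z : sin2 L z z = 0.
Proof. by rewrite /sin2 subrr sin0 expr0n. Qed.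

Lemma sin2_periodic L z t : L != 0 -> sin2 L z (t + L) = sin2 L z t.
Proof.
move=> L0; rewrite /sin2 mulrDr divfK// addrAC sinDpi.
by rewrite sqrrN.
Qed.

(** The sine is positive on ]0, pi[, which excludes every other point within one period of [z]. This
    range is enough, since points of the domain and mesh lines are at most one period apart. *)
Lemma sin2_eq0 L z t : 0 < L -> `|t - z| <= L -> sin2 L z t = 0 ->
  [\/ t = z, t = z - L | t = z + L].
Proof.
move=> L0 tz /eqP; rewrite sqrf_eq0 -mulrBr => /eqP sin0.
have p0 := pi_gt0 R; have pL0 : 0 < pi / L by rewrite divr_gt0.
have in_range u : 0 < u < L -> sin (pi / L * u) > 0.
  move=> /andP[u0 uL]; apply: sin_gt0_pi; rewrite mulr_gt0//=.
  by rewrite mulrAC ltr_pdivrMr// ltr_pM2l.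
move: tz; rewrite ler_norml => /andP[tz1 tz2].
have [tz|tz|->] := ltgtP t z; last by constructor 1.
- have [E|E] := eqVneq t (z - L); first by constructor 2.
  have /in_range : 0 < z - t < L.
    rewrite subr_gt0 tz lt_neqAle /=; apply/andP; split; last lra.
    by apply: contraNneq E => <-; apply/eqP; ring.
  by rewrite -opprB mulrN sinN sin0 oppr0 ltxx.
- have [E|E] := eqVneq t (z + L); first by constructor 3.
  have /in_range : 0 < t - z < L.
    rewrite subr_gt0 tz lt_neqAle /=; apply/andP; split; last lra.
    by apply: contraNneq E => <-; apply/eqP; ring.
  by rewrite sin0 ltxx.
Qed.

Lemma smooth_sin2x L z : smooth (fun x _ => sin2 L z x).
Proof. by apply: (smoothX (f := fun x _ => _)); exact/smooth_algebra/Asinx. Qed.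

Lemma smooth_sin2y L z : smooth (fun _ y => sin2 L z y).
Proof. by apply: (smoothX (f := fun _ y => _)); exact/smooth_algebra/Asiny. Qed.

Definition sin2s (L : R) (zs : seq R) (t : R) : R := \prod_(z <- zs) sin2 L z t.

Lemma sin2s_ge0 L zs t : 0 <= sin2s L zs t.
Proof. by apply: prodr_ge0 => z _; exact: sin2_ge0. Qed.

Lemma sin2s_le1 L zs t : sin2s L zs t <= 1.
Proof.
rewrite /sin2s; elim: zs => [|z s IHs]; first by rewrite big_nil.
by rewrite big_cons mulr_ile1 ?sin2_ge0 ?sin2_le1 ?prodr_ge0// => *; exact: sin2_ge0.
Qed.

Lemma sin2s_eq0 L zs t : (sin2s L zs t == 0) = has (fun z => sin2 L z t == 0) zs.
Proof. exact: prodf_seq_eq0. Qed.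

Lemma sin2s_mem L zs z : z \in zs -> sin2s L zs z = 0.
Proof.
by move=> zzs; apply/eqP; rewrite sin2s_eq0; apply/hasP; exists z => //;
  rewrite sin2_self.
Qed.

Lemma sin2s_periodic L zs t : L != 0 -> sin2s L zs (t + L) = sin2s L zs t.
Proof. by move=> L0; apply: eq_bigr => z _; exact: sin2_periodic. Qed.

(** Contains every zero of [sin2s L zs] at distance at most [L] from all entries of [zs]. The list
    is finite, so the lines it determines in the plane are negligible. *)
Definition exceptional (L : R) (zs : seq R) : seq R :=
  zs ++ [seq z - L | z <- zs] ++ [seq z + L | z <- zs].

Lemma sin2s_exceptional L zs t : 0 < L -> (forall z, z \in zs -> `|t - z| <= L) ->
  sin2s L zs t = 0 -> t \in exceptional L zs.
Proof.
move=> L0 tzs /eqP; rewrite sin2s_eq0 => /hasP[z zzs /eqP].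
rewrite !mem_cat => /(sin2_eq0 L0 (tzs z zzs))[]->; first by rewrite zzs.
- by have /= -> := map_f (fun z => z - L) zzs; rewrite orbT.
- by have /= -> := map_f (fun z => z + L) zzs; rewrite !orbT.
Qed.

Lemma negligible_seqx (s : seq R) : mu2.-negligible [set z : R * R | z.1 \in s].
Proof.
have cs : countable [set` s] by exact/finite_set_countable/finite_seq.
have ms : measurable [set` s].
  by apply: countable_measurable => // t; exact: measurable_set1.
rewrite (_ : [set z | _] = [set` s] `*` setT); last first.
  by apply/seteqP; split=> [z|z []].
apply/negligibleP; first exact: measurableX.
apply: etrans (product_measure1E mu mu ms measurableT) _.
by rewrite /= (countable_lebesgue_measure0 cs) mul0e.
Qed.

Lemma negligible_seqy (s : seq R) : mu2.-negligible [set z : R * R | z.2 \in s].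
Proof.
have cs : countable [set` s] by exact/finite_set_countable/finite_seq.
have ms : measurable [set` s].
  by apply: countable_measurable => // t; exact: measurable_set1.
rewrite (_ : [set z | _] = setT `*` [set` s]); last first.
  by apply/seteqP; split=> [z|z []].
apply/negligibleP; first exact: measurableX.
apply: etrans (product_measure1E mu mu measurableT ms) _.
by rewrite /= (countable_lebesgue_measure0 cs) mule0.
Qed.

Variables (Lx Ly : R) (xs ys : seq R).
Hypotheses (Lx_gt0 : 0 < Lx) (Ly_gt0 : 0 < Ly).

Definition cutoff (n : nat) (x y : R) : R :=
  1 - (1 - sin2s Lx xs x * sin2s Ly ys y) ^+ n.

Lemma smooth_cutoff n : smooth (cutoff n).
Proof.
have s1 : smooth (fun _ _ : R => 1 : R) by exact: smooth_cst.
apply: (smoothD s1); apply: smoothN; apply: (smoothX (f := fun x y => _)).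
apply: (smoothD s1); apply: smoothN; apply: (smoothM (f := fun x _ => _)).
- by apply: (@smooth_prod _ _ xs (fun z x _ => sin2 Lx z x)) => z; exact: smooth_sin2x.
- by apply: (@smooth_prod _ _ ys (fun z _ y => sin2 Ly z y)) => z; exact: smooth_sin2y.
Qed.

Lemma cutoff_eq0x n x y : x \in xs -> cutoff n x y = 0.
Proof. by move=> xxs; rewrite /cutoff sin2s_mem// mul0r subr0 expr1n subrr. Qed.

Lemma cutoff_eq0y n x y : y \in ys -> cutoff n x y = 0.
Proof.
by move=> yys; rewrite /cutoff [sin2s Ly _ _]sin2s_mem// mulr0 subr0 expr1n subrr.
Qed.

Let range01 x y : 0 <= 1 - sin2s Lx xs x * sin2s Ly ys y <= 1.
Proof.
by rewrite subr_ge0 mulr_ile1 ?sin2s_ge0 ?sin2s_le1//= gerBl mulr_ge0 ?sin2s_ge0.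
Qed.

Lemma norm_cutoff_le1 n x y : `|cutoff n x y| <= 1.
Proof.
have /andP[h0 h1] := range01 x y.
rewrite /cutoff ger0_norm ?subr_ge0 ?exprn_ile1//.
by rewrite gerBl exprn_ge0.
Qed.

Lemma cvg_cutoff x y : sin2s Lx xs x != 0 -> sin2s Ly ys y != 0 ->
  cutoff n x y @[n --> \oo] --> (1 : R).
Proof.
move=> x0 y0; rewrite -[X in _ --> X]subr0; apply: cvgB; first exact: cvg_cst.
apply: cvg_expr; have /andP[h0 h1] := range01 x y.
by rewrite ger0_norm// ltrBlDr ltrDl mulr_gt0// lt_neqAle eq_sym ?x0 ?y0 sin2s_ge0.
Qed.

Lemma cvg_Rintegral_cutoff (D : set (R * R)) (h : R * R -> R) :
  measurable D -> mu2.-integrable D (EFin \o h) ->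
  (forall x y, D (x, y) -> (forall s, s \in xs -> `|x - s| <= Lx) /\
    (forall s, s \in ys -> `|y - s| <= Ly)) ->
  \int[mu2]_(z in D) (h z * cutoff n z.1 z.2) @[n --> \oo]
  --> \int[mu2]_(z in D) h z.
Proof.
move=> mD ih Dnear.
have mh : measurable_fun D h.
  by apply/measurable_EFinP; exact: measurable_int ih.
have mc n : measurable_fun D (plane (cutoff n)).
  apply: continuous_measurable_plane; exact: smooth_continuous (smooth_cutoff n).
apply: fine_cvg; rewrite fineK; last exact: integrable_fin_num.
have [|||||_ _] := @dominated_convergence _ _ _ mu2 D mD
  (fun n z => (h z * cutoff n z.1 z.2)%:E) (EFin \o h) (abse \o (EFin \o h)).
- move=> n; apply/measurable_EFinP.
  exact: (measurable_funM mh (mc n)).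
- exact/measurable_EFinP.
(* Pointwise convergence can fail only where one of the two sine products vanishes, hence on
   finitely many vertical and horizontal lines. *)
- apply: negligibleS (negligibleU (negligible_seqx (exceptional Lx xs))
    (negligible_seqy (exceptional Ly ys))).
  move=> [x y] /= /not_implyP[Dxy]; have [nx ny] := Dnear _ _ Dxy.
  apply: contra_notP => /not_orP[xE yE].
  apply: cvg_EFin; first exact: nearW.
  rewrite -[X in _ --> X]mulr1; apply: cvgM; first exact: cvg_cst.
  apply: cvg_cutoff.
    by apply/eqP => H; apply: xE; exact: sin2s_exceptional.
  by apply/eqP => H; apply: yE; exact: sin2s_exceptional.
- exact: integrable_abse.
- apply: aeW => z n Dz /=; rewrite lee_fin normrM ler_piMr//.
  exact: norm_cutoff_le1.
- exact.
Qed.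

End cutoff.

(** * Weak and elementwise derivatives *)

Section broken_fields.
Context {R : realType} (M : mesh R).

Notation mu2 := (@lebesgue_measure R \x @lebesgue_measure R)%E.
Implicit Types (f g : bfield M) (phi psi : R -> R -> R).

Let Lx := mx1 M - mx0 M.
Let Ly := my1 M - my0 M.

Let Lx_gt0 : 0 < Lx. Proof. by rewrite subr_gt0 mesh_domx. Qed.
Let Ly_gt0 : 0 < Ly. Proof. by rewrite subr_gt0 mesh_domy. Qed.

Definition smooth_field f := forall K, smooth (f K).

Lemma bQ_smooth_field a b f : bQ a b f -> smooth_field f.
Proof. by move=> Qf K; exact: Qpoly_smooth (Qf K). Qed.

Lemma cell_subset_dom (K : elt M) : cell K `<=` dom M.
Proof. by move=> z Kz; rewrite /dom mesh_cover; exists K. Qed.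

Definition xlines : seq R :=
  [seq ex0 K | K <- enum (elt M)] ++ [seq ex1 K | K <- enum (elt M)].
Definition ylines : seq R :=
  [seq ey0 K | K <- enum (elt M)] ++ [seq ey1 K | K <- enum (elt M)].

Lemma ex_xlines (K : elt M) : ex0 K \in xlines /\ ex1 K \in xlines.
Proof. by rewrite !mem_cat !map_f ?mem_enum ?orbT. Qed.

Lemma ey_ylines (K : elt M) : ey0 K \in ylines /\ ey1 K \in ylines.
Proof. by rewrite !mem_cat !map_f ?mem_enum ?orbT. Qed.

Lemma edges_in_dom (K : elt M) :
  [/\ mx0 M <= ex0 K, ex1 K <= mx1 M, my0 M <= ey0 K & ey1 K <= my1 M].
Proof.
have [xK yK] := (mesh_eltx K, mesh_elty K).
have [] : dom M (ex0 K, ey0 K).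
  by apply: (@cell_subset_dom K); split; rewrite /= in_itv /= lexx ltW.
have [] : dom M (ex1 K, ey1 K).
  by apply: (@cell_subset_dom K); split; rewrite /= in_itv /= lexx ltW.
by rewrite /= !in_itv /= => /andP[_ ->] /andP[_ ->] /andP[-> _] /andP[-> _].
Qed.

Lemma dom_near_lines (x y : R) : dom M (x, y) ->
  (forall s, s \in xlines -> `|x - s| <= Lx) /\
  (forall s, s \in ylines -> `|y - s| <= Ly).
Proof.
rewrite /dom /= !in_itv /= => -[/andP[x0 x1] /andP[y0 y1]].
split=> s; rewrite mem_cat => /orP[] /mapP[K _ ->];
  have [? ? ? ?] := edges_in_dom K; have := mesh_eltx K; have := mesh_elty K;
  by rewrite /Lx /Ly ler_norml; move=> ? ?; apply/andP; split; lra.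
Qed.

Let cut n := cutoff Lx Ly xlines ylines n.

Lemma test_function_cutoff n psi : test_function M psi ->
  test_function M (fun x y => psi x y * cut n x y).
Proof.
move=> [spsi px py]; split=> [|x y|x y].
- by apply: smoothM; [exact: spsi|exact: smooth_cutoff].
- by rewrite px /cut /cutoff sin2s_periodic// gt_eqF.
- by rewrite py /cut /cutoff [sin2s Ly _ _]sin2s_periodic// gt_eqF.
Qed.

Lemma test_function_dx psi : test_function M psi -> test_function M (dx psi).
Proof.
move=> [spsi px py]; split=> [|x y|x y]; first exact: (smooth_dx spsi).
(* By periodicity [psi] equals its own translate; the chain rule, with inner derivative 1, carries
   this over to the derivative. *)
- apply/esym/dx_eq; rewrite (_ : psi ^~ y = (psi ^~ y) \o (fun s => s + Lx)).
    have H : is_derive x 1 (fun s : R => s + Lx) 1.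
      by apply: is_derive_eq; rewrite addr0.
    rewrite -[X in is_derive _ _ _ X]mulr1; apply: is_derive1_comp.
    exact/is_derive_dx/smooth_derivablex.
  by apply/funext => s /=; rewrite px.
- by rewrite /dx; congr derive1; apply/funext => s; exact: py.
Qed.

Lemma test_function_dy psi : test_function M psi -> test_function M (dy psi).
Proof.
move=> [spsi px py]; split=> [|x y|x y]; first exact: (smooth_dy spsi).
- by rewrite /dy; congr derive1; apply/funext => s; exact: px.
- apply/esym/dy_eq; rewrite (_ : psi x = psi x \o (fun s => s + Ly)).
    have H : is_derive y 1 (fun s : R => s + Ly) 1.
      by apply: is_derive_eq; rewrite addr0.
    rewrite -[X in is_derive _ _ _ X]mulr1; apply: is_derive1_comp.
    exact/is_derive_dy/smooth_derivabley.
  by apply/funext => s /=; rewrite py.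
Qed.

Lemma integrable_cell (K : elt M) (h : R * R -> R) : continuous h ->
  mu2.-integrable (cell K) (EFin \o h).
Proof. exact: integrable_box. Qed.

Lemma integrable_cellM (K : elt M) (u v : R -> R -> R) : smooth u -> smooth v ->
  mu2.-integrable (cell K) (EFin \o (fun z => u z.1 z.2 * v z.1 z.2)).
Proof.
by move=> su sv; apply: integrable_cell; exact: smooth_continuous (smoothM su sv).
Qed.

(** On each cell the two sides differ by the integral of the x-derivative of [f K * phi], which is
    zero because [phi] vanishes on both vertical edges. Jumps of [f] across these edges are thus
    invisible. *)
Lemma pair_broken_dx f phi : smooth_field f -> smooth phi ->
  (forall (K : elt M) y, phi (ex0 K) y = 0 /\ phi (ex1 K) y = 0) ->
  pair_broken f (dx phi) = - pair_broken (fun K => dx (f K)) phi.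
Proof.
move=> sf sphi phi0; apply/eqP; rewrite -addr_eq0 -big_split /=; apply/eqP.
apply: big1 => K _; rewrite -RintegralD; last 3 first.
- exact: measurable_box.
- exact: (integrable_cellM K (sf K) (smooth_dx sphi)).
- exact: (integrable_cellM K (smooth_dx (sf K)) sphi).
apply: etrans (_ : _ = \int[mu2]_(z in cell K)
    plane (dx (fun x y => f K x y * phi x y)) z) _.
  apply: eq_Rintegral => z _.
  rewrite /plane (dxM (smooth_der (sf K)) (smooth_der sphi)).
  by rewrite addrC.
apply: Rintegral_dx_eq0; [exact: mesh_eltx|exact: (smoothM (sf K) sphi)|] => y _.
by have [-> ->] := phi0 K y; rewrite !mulr0.
Qed.

Lemma pair_broken_dy f phi : smooth_field f -> smooth phi ->
  (forall (K : elt M) x, phi x (ey0 K) = 0 /\ phi x (ey1 K) = 0) ->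
  pair_broken f (dy phi) = - pair_broken (fun K => dy (f K)) phi.
Proof.
move=> sf sphi phi0; apply/eqP; rewrite -addr_eq0 -big_split /=; apply/eqP.
apply: big1 => K _; rewrite -RintegralD; last 3 first.
- exact: measurable_box.
- exact: (integrable_cellM K (sf K) (smooth_dy sphi)).
- exact: (integrable_cellM K (smooth_dy (sf K)) sphi).
apply: etrans (_ : _ = \int[mu2]_(z in cell K)
    plane (dy (fun x y => f K x y * phi x y)) z) _.
  apply: eq_Rintegral => z _.
  rewrite /plane (dyM (smooth_der (sf K)) (smooth_der sphi)).
  by rewrite addrC.
apply: Rintegral_dy_eq0; [exact: mesh_elty|exact: (smoothM (sf K) sphi)|] => x _.
by have [-> ->] := phi0 K x; rewrite !mulr0.
Qed.

(** The product is dominated by the sum of the two squares: that of [w] is integrable by assumption,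
    that of [psi] by continuity on a compact box. *)
Lemma L2_integrable (w : R * R -> R) psi : L2 M w -> smooth psi ->
  mu2.-integrable (dom M) (EFin \o (fun z => w z * psi z.1 z.2)).
Proof.
move=> Lw spsi.
have mD : measurable (dom M) by exact: measurable_box.
have mw : measurable_fun (dom M) w.
  have /andP[+ _] := Lw; rewrite inE /= => mw.
  by have := (measurable_restrict w mD measurableT).2 mw; rewrite setTI.
have cp2 : continuous (fun z : R * R => psi z.1 z.2 ^+ 2).
  exact: smooth_continuous (smoothX 2 spsi).
have iw : mu2.-integrable (dom M) (EFin \o (fun z => w z ^+ 2)).
  apply/(integrable_mkcond _ _).2; first exact: mD.
  have := Lfun2_integrable_sqr Lw.
  congr (integrable _ _ _); apply/funext => z /=.
  by rewrite !patchE; case: ifP => //; rewrite expr0n.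
have ip : mu2.-integrable (dom M) (EFin \o (fun z => psi z.1 z.2 ^+ 2)).
  exact: integrable_box.
apply: (le_integrable _ _ _ (integrableD _ iw ip)); try exact: measurable_box.
- apply/measurable_EFinP.
  apply: measurable_funM; first exact: mw.
  by apply: continuous_measurable_plane; exact: (smooth_continuous spsi).
- move=> z _; rewrite [X in (_ <= `|X|)%E](_ : _ = (w z ^+ 2 + psi z.1 z.2 ^+ 2)%:E)//.
  rewrite /= lee_fin normrM.
  rewrite (ger0_norm (addr_ge0 (sqr_ge0 _) (sqr_ge0 _))).
  rewrite -(real_normK (num_real (w z))) -(real_normK (num_real (psi _ _))).
  have AMGM (a b : R) : 0 <= a -> 0 <= b -> a * b <= a ^+ 2 + b ^+ 2.
    by move=> a0 b0; have := sqr_ge0 (a - b); have := mulr_ge0 a0 b0; nra.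
  exact: AMGM.
Qed.

Let cvg_pair_broken f psi : smooth_field f -> smooth psi ->
  pair_broken f (fun x y => psi x y * cut n x y) @[n --> \oo] --> pair_broken f psi.
Proof.
move=> sf spsi; apply: cvg_big => [|K _]; first exact: add_continuous.
rewrite (_ : (fun n => _) = fun n => \int[mu2]_(z in cell K)
    (f K z.1 z.2 * psi z.1 z.2 * cut n z.1 z.2)); last first.
  by apply/funext => n; apply: eq_Rintegral => z _; rewrite mulrA.
apply: (cvg_Rintegral_cutoff Lx_gt0 Ly_gt0 (measurable_box _ _ _ _)
  (integrable_cellM K (sf K) spsi)) => x y /cell_subset_dom.
exact: dom_near_lines.
Qed.

Let cvg_pair_global (w : R * R -> R) psi : L2 M w -> smooth psi ->
  pair_global M w (fun x y => psi x y * cut n x y) @[n --> \oo] --> pair_global M w psi.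
Proof.
move=> Lw spsi.
rewrite (_ : (fun n => _) = fun n => \int[mu2]_(z in dom M)
    (w z * psi z.1 z.2 * cut n z.1 z.2)); last first.
  by apply/funext => n; apply: eq_Rintegral => z _; rewrite mulrA.
apply: (cvg_Rintegral_cutoff Lx_gt0 Ly_gt0 (measurable_box _ _ _ _)
  (L2_integrable Lw spsi)) => x y.
exact: dom_near_lines.
Qed.

(* Multiplying the test function by cut-offs which vanish on the mesh lines
   and tend to 1 elsewhere removes the edge terms; hence the L2 weak
   derivative acts like the elementwise one. *)
Lemma weak_dx f (w : R * R -> R) psi : smooth_field f -> L2 M w ->
  (forall phi, test_function M phi -> pair_broken f (dx phi) = - pair_global M w phi) ->
  test_function M psi -> pair_global M w psi = pair_broken (fun K => dx (f K)) psi.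
Proof.
move=> sf Lw fw tpsi; have [spsi _ _] := tpsi.
apply: (@cvg_unique _ (@Rhausdorff R) _ _ _ _ (cvg_pair_global Lw spsi)).
rewrite (_ : (fun n => _) = fun n =>
  pair_broken (fun K => dx (f K)) (fun x y => psi x y * cut n x y)).
  by apply: (cvg_pair_broken _ spsi) => K; exact: smooth_dx (sf K).
apply/funext => n; apply: oppr_inj; rewrite -fw; last exact: test_function_cutoff.
have [sp _ _] := test_function_cutoff n tpsi.
apply: (pair_broken_dx sf sp) => K y; have [? ?] := ex_xlines K.
by rewrite /cut !cutoff_eq0x// !mulr0.
Qed.

Lemma weak_dy f (w : R * R -> R) psi : smooth_field f -> L2 M w ->
  (forall phi, test_function M phi -> pair_broken f (dy phi) = - pair_global M w phi) ->
  test_function M psi -> pair_global M w psi = pair_broken (fun K => dy (f K)) psi.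
Proof.
move=> sf Lw fw tpsi; have [spsi _ _] := tpsi.
apply: (@cvg_unique _ (@Rhausdorff R) _ _ _ _ (cvg_pair_global Lw spsi)).
rewrite (_ : (fun n => _) = fun n =>
  pair_broken (fun K => dy (f K)) (fun x y => psi x y * cut n x y)).
  by apply: (cvg_pair_broken _ spsi) => K; exact: smooth_dy (sf K).
apply/funext => n; apply: oppr_inj; rewrite -fw; last exact: test_function_cutoff.
have [sp _ _] := test_function_cutoff n tpsi.
apply: (pair_broken_dy sf sp) => K y; have [? ?] := ey_ylines K.
by rewrite /cut !cutoff_eq0y// !mulr0.
Qed.

End broken_fields.

(** * The curl and linear combinations of discrete fields *)

Section linear_structure.
Context {R : realType} (M : mesh R).

Notation mu2 := (@lebesgue_measure R \x @lebesgue_measure R)%E.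
Implicit Types (f g : bfield M) (r q : bfield M * bfield M) (A B C : vfield M).

Definition axpy (a : R) f g : bfield M := fun K x y => f K x y + a * g K x y.
Definition axpy2 a r q : bfield M * bfield M := (axpy a r.1 q.1, axpy a r.2 q.2).
Definition axpy3 a B C : vfield M := (axpy2 a B.1 C.1, axpy a B.2 C.2).

Lemma Qpoly_axpy m n (a : R) (u v : R -> R -> R) : Qpoly m n u -> Qpoly m n v ->
  Qpoly m n (fun x y => u x y + a * v x y).
Proof.
move=> [c uE] [d vE]; exists (c + a *: d) => x y; rewrite uE vE mulr_sumr -big_split.
apply: eq_bigr => i _; rewrite mulr_sumr -big_split; apply: eq_bigr => j _ /=.
by rewrite !mxE; ring.
Qed.

Lemma bQ_axpy m n a f g : bQ m n f -> bQ m n g -> bQ m n (axpy a f g).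
Proof. by move=> Qf Qg K; exact: Qpoly_axpy. Qed.

Lemma Qpoly0 m n : Qpoly m n (fun _ _ : R => 0).
Proof.
exists 0 => x y; rewrite big1// => i _; rewrite big1// => j _.
by rewrite mxE !mul0r.
Qed.

Lemma dx_axpy (a : R) (u v : R -> R -> R) : smooth u -> smooth v ->
  dx (fun x y => u x y + a * v x y) = fun x y => dx u x y + a * dx v x y.
Proof.
move=> su sv; apply/funext => x; apply/funext => y; apply: dx_eq.
have Hu : is_derive x 1 (u ^~ y) (dx u x y) by exact/is_derive_dx/smooth_derivablex.
have Hv : is_derive x 1 (v ^~ y) (dx v x y) by exact/is_derive_dx/smooth_derivablex.
exact: (is_deriveD Hu (is_deriveZ a Hv)).
Qed.

Lemma dy_axpy (a : R) (u v : R -> R -> R) : smooth u -> smooth v ->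
  dy (fun x y => u x y + a * v x y) = fun x y => dy u x y + a * dy v x y.
Proof.
move=> su sv; apply/funext => x; apply/funext => y; apply: dy_eq.
have Hu : is_derive y 1 (u x) (dy u x y) by exact/is_derive_dy/smooth_derivabley.
have Hv : is_derive y 1 (v x) (dy v x y) by exact/is_derive_dy/smooth_derivabley.
exact: (is_deriveD Hu (is_deriveZ a Hv)).
Qed.

Lemma dyN (u : R -> R -> R) x y : smooth u -> dy (fun x y => - u x y) x y = - dy u x y.
Proof.
move=> su; apply: dy_eq; apply: is_deriveN; exact/is_derive_dy/smooth_derivabley.
Qed.

Lemma div2_axpy2 a r q K x y :
  smooth_field r.1 -> smooth_field r.2 -> smooth_field q.1 -> smooth_field q.2 ->
  div2 (axpy2 a r q) K x y = div2 r K x y + a * div2 q K x y.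
Proof.
move=> sr1 sr2 sq1 sq2; rewrite /div2 /axpy2 /axpy /= dx_axpy// dy_axpy//; ring.
Qed.

Lemma pair_broken_axpy a f g phi : smooth_field f -> smooth_field g -> smooth phi ->
  pair_broken (axpy a f g) phi = pair_broken f phi + a * pair_broken g phi.
Proof.
move=> sf sg sphi; rewrite /pair_broken mulr_sumr -big_split /=.
apply: eq_bigr => K _; rewrite -RintegralZl; last 2 first.
- exact: measurable_box.
- exact: (integrable_cellM K (sg K) sphi).
rewrite -RintegralD; last 3 first.
- exact: measurable_box.
- exact: (integrable_cellM K (sf K) sphi).
- apply: (integrable_cell K (h := fun z => a * (g K z.1 z.2 * phi z.1 z.2))).
  exact: smooth_continuous (smoothM (smooth_cst a) (smoothM (sg K) sphi)).
by apply: eq_Rintegral => z _; rewrite /axpy mulrDl mulrA.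
Qed.

Lemma L2_axpy (a : R) (u v : R * R -> R) : L2 M u -> L2 M v ->
  L2 M (fun z => u z + a * v z).
Proof.
move=> Lu Lv; have p1 : (1 <= 2%:E :> \bar R)%E by rewrite lee_fin ler1n.
have [_ /(_ a _ _ Lv Lu) H] := Lfun_submod_closed mu2 p1.
rewrite /L2 (_ : _ \_ _ = a *: (v \_ (dom M)) + u \_ (dom M))//; apply/funext => z /=.
rewrite patchE fctE /GRing.scale /= !patchE; case: ifP => _; first by rewrite addrC.
(* Outside the domain a restricted function takes the default value [point], which is 0 for reals,
   so restriction is linear there too. *)
have -> : point = 0 :> R by []; by rewrite scaler0 addr0.
Qed.

Lemma L2_0 : L2 M (fun=> 0).
Proof.
have p1 : (1 <= 2%:E :> \bar R)%E by rewrite lee_fin ler1n.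
have [H _] := Lfun_submod_closed mu2 p1.
rewrite /L2 (_ : _ \_ _ = 0)//; apply/funext => z /=.
by rewrite patchE; case: ifP.
Qed.

Lemma pair_global_axpy (a : R) (u v : R * R -> R) phi :
  L2 M u -> L2 M v -> smooth phi ->
  pair_global M (fun z => u z + a * v z) phi =
  pair_global M u phi + a * pair_global M v phi.
Proof.
move=> Lu Lv sphi; have iu := L2_integrable Lu sphi; have iv := L2_integrable Lv sphi.
rewrite /pair_global -RintegralZl//; last exact: measurable_box.
rewrite -RintegralD//; last 2 first.
- exact: measurable_box.
- rewrite (_ : _ \o _ = fun z => (a%:E * (v z * phi z.1 z.2)%:E)%E); last first.
    by apply/funext => z /=; rewrite EFinM.
  by apply: integrableZl => //; exact: measurable_box.
by apply: eq_Rintegral => z _; rewrite mulrDl mulrA.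
Qed.

Lemma Rh_smooth m r : Rh m r -> smooth_field r.1 /\ smooth_field r.2.
Proof.
by move=> [Q1 Q2 _]; split; [exact: bQ_smooth_field Q1|exact: bQ_smooth_field Q2].
Qed.

Lemma Rh_axpy m a r q : Rh m r -> Rh m q -> Rh m (axpy2 a r q).
Proof.
move=> Hr Hq; have [sr1 sr2] := Rh_smooth Hr; have [sq1 sq2] := Rh_smooth Hq.
have [Qr1 Qr2 [u [Lu ru]]] := Hr; have [Qq1 Qq2 [v [Lv qv]]] := Hq.
split; [exact: bQ_axpy|exact: bQ_axpy|].
exists (fun z => u z + a * v z); split; first exact: L2_axpy.
move=> phi tphi; have [sphi _ _] := tphi.
have [sx sy] := (smooth_dx sphi, smooth_dy sphi).
apply: etrans (congr2 +%R (pair_broken_axpy a sr1 sq1 sx)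
  (pair_broken_axpy a sr2 sq2 sy)) _.
apply: etrans _ (esym (congr1 -%R (pair_global_axpy a Lu Lv sphi))).
have lin (A B C D U V : R) : A + B = - U -> C + D = - V ->
    A + a * C + (B + a * D) = - (U + a * V).
  by move=> EU EV; rewrite opprD -mulrN -EU -EV; ring.
exact: lin (ru _ tphi) (qv _ tphi).
Qed.

Lemma pair_broken0 phi : pair_broken ((fun _ _ _ => 0) : bfield M) phi = 0.
Proof.
rewrite /pair_broken big1// => K _; under eq_Rintegral do rewrite mul0r.
by rewrite Rintegral_cst ?mul0r//; exact: measurable_box.
Qed.

Lemma pair_global0 phi : pair_global M (fun=> 0) phi = 0.
Proof.
rewrite /pair_global; under eq_Rintegral do rewrite mul0r.
by rewrite Rintegral_cst ?mul0r//; exact: measurable_box.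
Qed.

Lemma Rh0 m : Rh m ((fun _ _ _ => 0, fun _ _ _ => 0) : bfield M * bfield M).
Proof.
split; try by move=> K; exact: Qpoly0.
exists (fun=> 0); split; first exact: L2_0.
by move=> phi _; rewrite !pair_broken0 pair_global0 oppr0 addr0.
Qed.

Lemma Bh_axpy m a B C : Bh m B -> Bh m C -> Bh m (axpy3 a B C).
Proof. by move=> [R1 V1] [R2 V2]; split; [exact: Rh_axpy|exact: bQ_axpy]. Qed.

Lemma Bh0 m : Bh m (((fun _ _ _ => 0, fun _ _ _ => 0), fun _ _ _ => 0) : vfield M).
Proof. by split; [exact: Rh0|move=> K; exact: Qpoly0]. Qed.

Lemma is_derive_monomial n (x : R) :
  is_derive x 1 (fun s : R => s ^+ n.+1) (n.+1%:R * x ^+ n).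
Proof.
have Hid : is_derive x 1 (fun s : R => s) 1 by exact: is_derive_id.
elim: n => [|n IHn]; first by rewrite mul1r.
rewrite (_ : (fun s => _) = fun s => s * s ^+ n.+1); last first.
  by apply/funext => s; rewrite exprS.
apply: is_derive_eq (is_deriveM Hid IHn) _.
by rewrite /GRing.scale /= exprS; ring.
Qed.

Lemma Qpoly_dx m n (u : R -> R -> R) : Qpoly m.+1 n u -> Qpoly m n (dx u).
Proof.
(* Row 0, constant in x, disappears; row i + 1 becomes row i with the factor i + 1. Below, [k i] is
   the coefficient of the i-th power of x at the fixed [y]. *)
move=> [c uE]; exists (\matrix_(i, j) (c (lift ord0 i) j * i.+1%:R)) => x y.
pose k i : R := \sum_(j < n.+1) c i j * y ^+ j.
apply: dx_eq; rewrite (_ : u ^~ y = (fun=> k ord0) +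
    \sum_(i < m.+1) (fun s : R => k (lift ord0 i) * s ^+ i.+1)); last first.
  apply/funext => s /=; rewrite uE big_ord_recl fctE fct_sumE; congr (_ + _).
    by apply: eq_bigr => j _; rewrite expr0 mulr1.
  apply: eq_bigr => i _; rewrite mulr_suml.
  by apply: eq_bigr => j _; rewrite lift0; ring.
have Hmono (i : 'I_m.+1) : is_derive x 1 (fun s : R => k (lift ord0 i) * s ^+ i.+1)
    (k (lift ord0 i) * (i.+1%:R * x ^+ i)).
  exact: (is_deriveZ (k (lift ord0 i)) (is_derive_monomial i x)).
apply: is_derive_eq (is_deriveD (is_derive_cst _ _ _) (is_derive_sum Hmono)) _.
rewrite add0r; apply: eq_bigr => i _; rewrite mulr_suml.
by apply: eq_bigr => j _; rewrite mxE; ring.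
Qed.

Lemma Qpoly_swap m n (u : R -> R -> R) : Qpoly m n u -> Qpoly n m (fun x y => u y x).
Proof.
move=> [c uE]; exists c^T => x y; rewrite uE exchange_big.
by apply: eq_bigr => i _; apply: eq_bigr => j _; rewrite mxE mulrAC.
Qed.

Lemma Qpoly_dy m n (u : R -> R -> R) : Qpoly m n.+1 u -> Qpoly m n (dy u).
Proof. by move=> /Qpoly_swap/Qpoly_dx/Qpoly_swap. Qed.

Lemma QpolyN m n (u : R -> R -> R) : Qpoly m n u -> Qpoly m n (fun x y => - u x y).
Proof.
move=> /(Qpoly_axpy (-1) (Qpoly0 m n)); congr Qpoly.
by apply/funext => x; apply/funext => y; rewrite add0r mulN1r.
Qed.

Lemma smooth_field0 : smooth_field ((fun _ _ _ => 0) : bfield M).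
Proof. by move=> K; exact: smooth_cst. Qed.

Lemma pair_brokenN f phi : smooth_field f -> smooth phi ->
  pair_broken (fun K x y => - f K x y) phi = - pair_broken f phi.
Proof.
move=> sf sphi; rewrite -mulN1r -[RHS]add0r -(pair_broken0 phi).
rewrite -(pair_broken_axpy (-1) smooth_field0 sf sphi); congr pair_broken.
apply/funext => K; apply/funext => x; apply/funext => y.
by rewrite /axpy add0r mulN1r.
Qed.

Lemma Hdiv_curl f : smooth_field f -> H1 f ->
  Hdiv ((fun K => dy (f K), fun K x y => - dx (f K) x y) : bfield M * bfield M).
Proof.
move=> sf [gx [gy [Lgx Lgy fg]]]; exists (fun=> 0); split; first exact: L2_0.
move=> phi tphi; have [sphi _ _] := tphi; rewrite pair_global0 oppr0 /=.
have [tx ty] := (test_function_dx tphi, test_function_dy tphi).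
have sdx : smooth_field (fun K => dx (f K)) by move=> K; exact: smooth_dx (sf K).
have fx psi : test_function M psi -> pair_broken f (dx psi) = - pair_global M gx psi.
  by move=> /fg[].
have fy psi : test_function M psi -> pair_broken f (dy psi) = - pair_global M gy psi.
  by move=> /fg[].
(* The derivatives of [phi] are themselves test functions: both sides are minus the pairing of [f]
   with the mixed second derivative of [phi]. It then remains to replace [gx] and [gy] by the
   elementwise derivatives. *)
have E : pair_global M gy (dx phi) = pair_global M gx (dy phi).
  have dxy : dy (dx phi) = dx (dy phi).
    by apply/funext => x; apply/funext => y; rewrite -(dx_dyC x y sphi).
  exact: (oppr_inj (etrans (esym (fy _ tx))
    (etrans (congr1 (pair_broken f) dxy) (fx _ ty)))).
apply: etrans (congr1 (+%R _) (pair_brokenN sdx (smooth_dy sphi))) _.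
apply/eqP; rewrite subr_eq0; apply/eqP.
apply: etrans (esym (weak_dy sf Lgy fy tx)) (etrans E _).
exact: weak_dx.
Qed.

Lemma curl_Bh m A : Ah m A -> Bh m (curl A).
Proof.
move=> [[Q1 Q2 _] [Q3 HA]]; split; last first.
  move=> K; have H1 := Qpoly_dx (Q2 K); have H2 := QpolyN (Qpoly_dy (Q1 K)).
  have := Qpoly_axpy 1 H1 H2; congr Qpoly.
  by apply/funext => x; apply/funext => y; rewrite mul1r.
split=> [K|K|].
- exact: Qpoly_dy (Q3 K).
- exact: QpolyN (Qpoly_dx (Q3 K)).
- exact: (Hdiv_curl (bQ_smooth_field Q3) HA).
Qed.

Lemma div2_curl A K x y : smooth_field A.2 -> div2 (curl A).1 K x y = 0.
Proof.
move=> sA; have sAK := sA K.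
apply: etrans (congr2 +%R (dx_dyC x y sAK) (dyN x y (smooth_dx sAK))) _.
exact: subrr.
Qed.

Definition Rh_divfree m r := Rh m r /\ divfree r.

Lemma Rh_divfree_axpy m a r q : Rh_divfree m r -> Rh_divfree m q ->
  Rh_divfree m (axpy2 a r q).
Proof.
move=> [Hr dr] [Hq dq]; split; first exact: Rh_axpy.
have [sr1 sr2] := Rh_smooth Hr; have [sq1 sq2] := Rh_smooth Hq.
by move=> K x y Kxy; rewrite div2_axpy2// dr// dq// mulr0 addr0.
Qed.

Lemma Rh_divfree0 m :
  Rh_divfree m ((fun _ _ _ => 0, fun _ _ _ => 0) : bfield M * bfield M).
Proof.
split=> [|K x y _]; first exact: Rh0.
by rewrite /div2 /dx /dy !derive1_cst addr0.
Qed.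

Lemma Rh_divfree_curl m A : Ah m A -> Rh_divfree m (curl A).1.
Proof.
move=> HA; split; first by have [] := curl_Bh HA.
by move=> K x y _; apply: div2_curl; case: HA => _ [/bQ_smooth_field].
Qed.

(** Serves both the stages, where [P] selects [j < i], and the final update, where [P] is
    [xpredT]. *)
Lemma Rh_divfree_vstep m n B tau (P : pred 'I_n) c (F : 'I_n -> vfield M) :
  Rh_divfree m B.1 -> (forall j, Rh_divfree m (F j).1) ->
  Rh_divfree m (vstep B tau P c F).1.
Proof.
move=> HB HF.
(* The enumeration of the indices is replaced by an arbitrary list, on which induction is
   possible. *)
suff HS s : Rh_divfree m ((fun K x y => \sum_(j <- s | P j) c j * (F j).1.1 K x y,
    fun K x y => \sum_(j <- s | P j) c j * (F j).1.2 K x y) : bfield M * bfield M).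
  have := Rh_divfree_axpy (- tau) HB (HS (index_enum 'I_n)); congr Rh_divfree.
  by congr pair; apply/funext => K; apply/funext => x; apply/funext => y;
    rewrite /axpy mulNr.
elim: s => [|j s IHs].
  have := Rh_divfree0 m; congr Rh_divfree.
  by congr pair; apply/funext => K; apply/funext => x; apply/funext => y;
    rewrite big_nil.
have [Pj|Pj] := boolP (P j).
  have := Rh_divfree_axpy (c j) IHs (HF j); congr Rh_divfree.
  by congr pair; apply/funext => K; apply/funext => x; apply/funext => y;
    rewrite big_cons Pj /axpy addrC.
move: IHs; congr Rh_divfree.
by congr pair; apply/funext => K; apply/funext => x; apply/funext => y;
  rewrite big_cons (negbTE Pj).
Qed.

End linear_structure.

(** * The divergence as a quadrature functional *)

Section finite_dimensional_riesz.
Context {F : fieldType} {V : vectType F}.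

(** Take a subspace inside [P] of maximal dimension: adjoining the line of a vector satisfying [P]
    stays inside [P], so by maximality it adds nothing. This makes a vector space out of a space
    known only through a predicate, such as [Bh] with its weak divergence condition, for which no
    basis is at hand. *)
Lemma subspace_of_pred (P : V -> Prop) : P 0 ->
  (forall a u v, P u -> P v -> P (a *: u + v)) ->
  exists U : {vspace V}, forall v, v \in U <-> P v.
Proof.
move=> P0 Plin.
pose Q k := `[< exists U : {vspace V}, \dim U = k /\ forall v, v \in U -> P v >].
have exQ : exists k, Q k.
  exists 0%N; apply/asboolP; exists 0%VS; rewrite dimv0; split=> // v.
  by rewrite memv0 => /eqP ->.
have Qle k : Q k -> (k <= \dim {: V})%N.
  by move=> /asboolP[U [<- _]]; rewrite dimvS ?subvf.
case: (ex_maxnP exQ Qle) => k /asboolP[U [dimU PU]] kmax.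
exists U => v; split=> [/PU//|Pv].
have : Q (\dim (U + <[v]>)%VS).
  apply/asboolP; exists (U + <[v]>)%VS; split=> // _
    /memv_addP[u /PU Pu [_ /vlineP[a ->] ->]].
  by rewrite addrC; exact: Plin.
move=> /kmax; rewrite -dimU => dimle.
have /eqP -> : U == (U + <[v]>)%VS :> {vspace V} by rewrite eqEdim addvSl.
exact: (subvP (addvSr U <[v]>)) (memv_line v).
Qed.

Lemma linear_sum (f : V -> F) n (x : 'I_n -> F) (w : 'I_n -> V) :
  (forall a u v, f (a *: u + v) = a * f u + f v) ->
  f (\sum_i x i *: w i) = \sum_i x i * f (w i).
Proof.
move=> flin.
have f0 : f 0 = 0.
  have := flin 1 0 0; rewrite scaler0 addr0 mul1r => /eqP.
  by rewrite -subr_eq subrr eq_sym => /eqP.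
elim: n x w => [|n IHn] x w; first by rewrite !big_ord0.
by rewrite !big_ord_recl flin IHn.
Qed.

(** The form may be degenerate. In a basis of [U] the representing vector solves a linear system
    with the Gram matrix, which is solvable once [lambda] vanishes on the kernel of that matrix;
    kernel vectors are isotropic, and there [lambda] vanishes by assumption. *)
Lemma riesz (U : {vspace V}) (beta : V -> V -> F) (lambda : V -> F) :
  (forall a u v, lambda (a *: u + v) = a * lambda u + lambda v) ->
  (forall w a u v, beta (a *: u + v) w = a * beta u w + beta v w) ->
  (forall u v, beta u v = beta v u) ->
  (forall u, u \in U -> beta u u = 0 -> lambda u = 0) ->
  exists2 c, c \in U & forall u, u \in U -> lambda u = beta u c.
Proof.
move=> lamlin betalin betaC ker; set n := \dim U; pose e i := (vbasis U)`_i.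
have eU (x : 'I_n -> F) : \sum_(i < n) x i *: e i \in U.
  by apply: memv_suml => i _; rewrite memvZ// vbasis_mem// mem_nth// size_tuple.
have betalinr w a u v : beta w (a *: u + v) = a * beta w u + beta w v.
  by rewrite betaC betalin !(betaC w).
pose A := \matrix_(i < n, j < n) beta (e i) (e j).
pose l := \row_(j < n) lambda (e j).
have /submxP[x lE] : (l <= A)%MS.
  rewrite submxE; apply/eqP/rowP => j; rewrite !mxE.
  (* The columns of [cokermx A] are killed by the Gram matrix [A], so [u] is orthogonal to every
     basis vector and in particular to itself. The entry to be shown zero is [lambda u]. *)
  pose u := \sum_(i < n) cokermx A i j *: e i.
  rewrite (_ : \sum_i _ = lambda u); last first.
    by rewrite linear_sum//; apply: eq_bigr => i _; rewrite mxE mulrC.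
  apply: ker; first exact: eU.
  rewrite (linear_sum _ _ (betalin u)) big1// => i _.
  rewrite (linear_sum _ _ (betalinr (e i))).
  have := congr1 (fun B : 'M[F]_n => B i j) (mulmx_coker A).
  rewrite !mxE => E; apply: etrans (congr1 ( *%R _) (etrans _ E)) (mulr0 _).
  by apply: eq_bigr => k _; rewrite [A i k]mxE mulrC.
exists (\sum_(i < n) x 0 i *: e i) => [|u uU]; first exact: eU.
rewrite (coord_vbasis uU) (linear_sum _ _ lamlin) (linear_sum _ _ (betalin _)).
apply: eq_bigr => j _; congr (_ * _).
have := congr1 (fun B : 'rV[F]_n => B 0 j) lE; rewrite !mxE => ->.
rewrite (linear_sum _ _ (betalinr _)).
by apply: eq_bigr => i _; rewrite mxE betaC.
Qed.

End finite_dimensional_riesz.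

(** * The magnetic quadrature product on polynomial coefficients *)

Section quadrature_form.
Context {R : realType} (M : mesh R) (Q : rules (R := R)).

Notation mu2 := (@lebesgue_measure R \x @lebesgue_measure R)%E.
Implicit Types (B C D : vfield M).

Lemma tensor_axpy r s (qx : quad r) (qy : quad s) (a : R) (f g : bfield M) :
  tensor qx qy (axpy a f g) = tensor qx qy f + a * tensor qx qy g.
Proof.
rewrite /tensor mulr_sumr -big_split; apply: eq_bigr => K _ /=.
rewrite mulrCA -mulrDr; congr (_ * _); rewrite mulr_sumr -big_split.
apply: eq_bigr => i _ /=; rewrite mulr_sumr -big_split.
by apply: eq_bigr => j _ /=; rewrite /axpy; ring.
Qed.

Lemma ipB_axpy a B C D : ipB Q (axpy3 a B C) D = ipB Q B D + a * ipB Q C D.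
Proof.
have E (f g h : bfield M) : (fun K x y => axpy a f g K x y * h K x y)
    = axpy a (fun K x y => f K x y * h K x y) (fun K x y => g K x y * h K x y).
  by apply/funext => K; apply/funext => x; apply/funext => y; rewrite /axpy; ring.
by rewrite /ipB /= !E !tensor_axpy; ring.
Qed.

Lemma ipBC B C : ipB Q B C = ipB Q C B.
Proof.
have E (f g : bfield M) :
    (fun K x y => f K x y * g K x y) = (fun K x y => g K x y * f K x y).
  by apply/funext => K; apply/funext => x; apply/funext => y; rewrite mulrC.
by rewrite /ipB (E B.1.1) (E B.1.2) (E B.2).
Qed.

Lemma Bh_smooth m C : Bh m C ->
  [/\ smooth_field C.1.1, smooth_field C.1.2 & smooth_field C.2].
Proof. by move=> [/Rh_smooth[s1 s2] /bQ_smooth_field s3]. Qed.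

Lemma int_broken_eq0 m C : Bh m C -> int_broken (dot C C) = 0 ->
  forall K x y, cell K (x, y) -> C.1.1 K x y = 0 /\ C.1.2 K x y = 0.
Proof.
move=> /Bh_smooth[s1 s2 s3] /eqP; rewrite psumr_eq0; last first.
  move=> K _; apply: Rintegral_ge0 => z _.
  by rewrite /dot -!expr2 !addr_ge0 ?sqr_ge0.
move=> /allP int0 K.
have /eqP intK : \int[mu2]_(z in cell K) dot C C K z.1 z.2 == 0.
  exact: int0 K (mem_index_enum K).
have sdot : smooth (dot C C K).
  by apply: smoothD; [apply: smoothD|]; apply: smoothM.
have comp0 (f : R -> R -> R) : smooth f ->
    (forall x y, f x y ^+ 2 <= dot C C K x y) -> forall x y, cell K (x, y) -> f x y = 0.
  move=> sf fle x y Kxy.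
  apply: (Rintegral_sqr_eq0 (mesh_eltx K) (mesh_elty K) (smooth_continuous sf) _ Kxy).
  apply/eqP; rewrite eq_le; apply/andP; split; last first.
    by apply: Rintegral_ge0 => z _; exact: sqr_ge0.
  rewrite -[X in _ <= X]intK; apply: le_Rintegral => [|||z _].
  - exact: measurable_box.
  - exact: integrable_box (smooth_continuous (smoothX 2 sf)).
  - exact: integrable_box (smooth_continuous sdot).
  - exact: fle.
move=> x y Kxy; split.
- apply: (comp0 _ (s1 K) _ _ _ Kxy) => s t.
  by rewrite /dot -!expr2 -addrA lerDl addr_ge0 ?sqr_ge0.
- apply: (comp0 _ (s2 K) _ _ _ Kxy) => s t.
  by rewrite /dot -!expr2 addrAC lerDr addr_ge0 ?sqr_ge0.
Qed.

(** This is the kernel condition of [riesz] for the divergence. Exactness turns the hypothesis into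
    a vanishing integral of the squared length, so the in-plane components are zero on each closed
    cell, and so are their derivatives, also at its boundary. *)
Lemma ipB_definite m C : admissible M Q m -> Bh m C -> ipB Q C C = 0 -> divfree C.1.
Proof.
move=> [_ _ exact_ip] HC; rewrite exact_ip// => int0 K x y Kxy.
have [s1 s2 _] := Bh_smooth HC; have C0 := int_broken_eq0 HC int0.
have C1 s t : cell K (s, t) -> C.1.1 K s t = 0 by move=> /C0[].
have C2 s t : cell K (s, t) -> C.1.2 K s t = 0 by move=> /C0[].
have [dx0 _] := smooth_box_eq0 (mesh_eltx K) (mesh_elty K) (s1 K) C1 Kxy.
have [_ dy0] := smooth_box_eq0 (mesh_eltx K) (mesh_elty K) (s2 K) C2 Kxy.
exact: etrans (congr2 +%R dx0 dy0) (addr0 0).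
Qed.

Definition bivariate a b (c : 'M[R]_(a.+1, b.+1)) (x y : R) : R :=
  \sum_(i < a.+1) \sum_(j < b.+1) c i j * x ^+ i * y ^+ j.

(** A finite-dimensional vector space that parametrizes the broken polynomial fields; degree d takes
    d + 1 coefficients. The H(div) coupling between cells is not encoded here but cut out afterwards
    by [subspace_of_pred]. *)
Definition coefficients m :=
  {ffun elt M -> ('M[R]_(m.+2, m.+1) * 'M[R]_(m.+1, m.+2)) * 'M[R]_(m.+1, m.+1)}.

Definition field_of m (v : coefficients m) : vfield M :=
  ((fun K => bivariate (v K).1.1, fun K => bivariate (v K).1.2),
   fun K => bivariate (v K).2).

Lemma bivariate_axpy m n a (c d : 'M[R]_(m.+1, n.+1)) x y :
  bivariate (a *: c + d) x y = bivariate d x y + a * bivariate c x y.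
Proof.
rewrite /bivariate mulr_sumr -big_split; apply: eq_bigr => i _ /=.
rewrite mulr_sumr -big_split; apply: eq_bigr => j _ /=.
by rewrite !mxE; ring.
Qed.

Lemma field_of_axpy m a (u v : coefficients m) :
  field_of (a *: u + v) = axpy3 a (field_of v) (field_of u).
Proof.
by congr (_, _, _); apply/funext => K; apply/funext => x; apply/funext => y;
  rewrite /axpy /= !ffunE bivariate_axpy.
Qed.

Lemma Bh_field_of m B : Bh m B -> exists v : coefficients m, B = field_of v.
Proof.
move=> [[Q1 Q2 _] Q3].
have [c1 c1E] := choice Q1; have [c2 c2E] := choice Q2; have [c3 c3E] := choice Q3.
exists [ffun K => ((c1 K, c2 K), c3 K)].
case: B {Q1 Q2 Q3} c1E c2E c3E => [[B1 B2] B3] /= c1E c2E c3E.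
by congr (_, _, _); apply/funext => K; apply/funext => x; apply/funext => y;
  rewrite ffunE /= ?c1E ?c2E ?c3E.
Qed.

Lemma div2_riesz m K x y : admissible M Q m -> cell K (x, y) ->
  exists2 C : vfield M, Bh m C & forall B, Bh m B -> div2 B.1 K x y = ipB Q B C.
Proof.
move=> Qok Kxy.
(* [riesz] asks for linearity of the functional on all coefficients, also those of fields outside
   H(div), so smoothness cannot be drawn from [Bh]. *)
have smooth_of (v : coefficients m) :
    smooth_field (field_of v).1.1 /\ smooth_field (field_of v).1.2.
  by split=> L; [apply: (@Qpoly_smooth _ m.+1 m)|apply: (@Qpoly_smooth _ m m.+1)];
    eexists.
have [||U UP] := @subspace_of_pred R (coefficients m) (fun v => Bh m (field_of v)).
- have := Bh0 M m; congr Bh.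
  by congr (_, _, _); apply/funext => L; apply/funext => s; apply/funext => t;
    rewrite /bivariate big1// => i _; rewrite big1// => j _; rewrite ffunE mxE !mul0r.
- by move=> a u v Hu Hv; rewrite field_of_axpy; exact: Bh_axpy.
have [||||c /UP Hc lamE] := @riesz R (coefficients m) U
  (fun u v => ipB Q (field_of u) (field_of v)) (fun v => div2 (field_of v).1 K x y).
- move=> a u v; rewrite field_of_axpy addrC.
  have [? ?] := smooth_of u; have [? ?] := smooth_of v.
  exact: div2_axpy2.
- by move=> w a u v; rewrite field_of_axpy ipB_axpy addrC.
- by move=> u v; exact: ipBC.
- by move=> u /UP Hu /(ipB_definite Qok Hu); exact.
exists (field_of c) => // B HB; have [v BE] := Bh_field_of HB.
by rewrite BE; apply: lamE; apply/UP; rewrite -BE.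
Qed.

End quadrature_form.

(** * Time dependence *)

Section time_derivative.
Context {R : realType} (M : mesh R).
Implicit Types (B : R -> vfield M) (C : vfield M).

Lemma is_derive_big (I : Type) (s : seq I) (F : I -> R -> R) (d : I -> R) (t : R) :
  (forall i, is_derive t 1 (F i) (d i)) ->
  is_derive t 1 (fun z => \sum_(i <- s) F i z) (\sum_(i <- s) d i).
Proof.
move=> H; elim: s => [|i s IHs].
  rewrite big_nil (_ : (fun _ => _) = fun=> 0); first exact: is_derive_cst.
  by apply/funext => z; rewrite big_nil.
rewrite big_cons (_ : (fun _ => _) = fun z => F i z + \sum_(j <- s) F j z).
  exact: is_deriveD.
by apply/funext => z; rewrite big_cons.
Qed.

(** A rule is a finite combination of point values, so derivability in time at each point is enough;
    nothing is assumed about how [dt f t] depends on space. *)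
Lemma is_derive_tensor r s (qx : quad r) (qy : quad s) (f : R -> bfield M)
    (g : bfield M) (t : R) :
  (forall K x y, derivable (fun z => f z K x y) t 1) ->
  is_derive t 1 (fun z => tensor qx qy (fun K x y => f z K x y * g K x y))
    (tensor qx qy (fun K x y => dt f t K x y * g K x y)).
Proof.
move=> df; apply: is_derive_big => K; apply: (is_deriveZ (jac K)).
apply: is_derive_big => i; apply: is_derive_big => j.
apply: (is_deriveZ (wgt qx i * wgt qy j)); rewrite mulrC.
have -> (h : R -> R) (k : R) : (fun z => h z * k) = k \*: h.
  by apply/funext => z; rewrite mulrC.
apply: is_deriveZ; apply: DeriveDef => //.
by rewrite /dt derive1E.
Qed.

Lemma is_derive_ipB (Q : rules (R := R)) B C (t : R) :
  (forall K x y, derivable (fun z => (B z).1.1 K x y) t 1) ->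
  (forall K x y, derivable (fun z => (B z).1.2 K x y) t 1) ->
  (forall K x y, derivable (fun z => (B z).2 K x y) t 1) ->
  is_derive t 1 (fun z => ipB Q (B z) C) (ipB Q (vdt B t) C).
Proof.
move=> d1 d2 d3; apply: is_deriveD; first apply: is_deriveD.
- exact: (@is_derive_tensor _ _ _ _ (fun z => (B z).1.1) _ _ d1).
- exact: (@is_derive_tensor _ _ _ _ (fun z => (B z).1.2) _ _ d2).
- exact: (@is_derive_tensor _ _ _ _ (fun z => (B z).2) _ _ d3).
Qed.

(** The filter is arbitrary so that the lemma covers continuity relative to [[0, T]], including its
    end points. *)
Lemma cvg_tensor (T : Type) (G : set_system T) (FG : Filter G) r s (qx : quad r)
    (qy : quad s) (f : T -> bfield M) (l g : bfield M) :
  (forall K x y, f z K x y @[z --> G] --> l K x y) ->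
  tensor qx qy (fun K x y => f z K x y * g K x y) @[z --> G]
  --> tensor qx qy (fun K x y => l K x y * g K x y).
Proof.
move=> fl; apply: cvg_big => [|K _]; first exact: add_continuous.
apply: cvgM; first exact: cvg_cst.
apply: cvg_big => [|i _]; first exact: add_continuous.
apply: cvg_big => [|j _]; first exact: add_continuous.
apply: cvgM; first exact: cvg_cst.
by apply: cvgM; [exact: fl|exact: cvg_cst].
Qed.

Lemma within_continuous_ipB (Q : rules (R := R)) T B C : vtime_regular T B ->
  {within `[0, T], continuous (fun z => ipB Q (B z) C)}.
Proof.
move=> [r1 r2 r3] t; apply: cvgD; first apply: cvgD.
- apply: (@cvg_tensor _ _ (nbhs_filter t) _ _ _ _ (fun z => (B z).1.1)) => K x y.
  by have [+ _] := r1 K x y; exact.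
- apply: (@cvg_tensor _ _ (nbhs_filter t) _ _ _ _ (fun z => (B z).1.2)) => K x y.
  by have [+ _] := r2 K x y; exact.
- apply: (@cvg_tensor _ _ (nbhs_filter t) _ _ _ _ (fun z => (B z).2)) => K x y.
  by have [+ _] := r3 K x y; exact.
Qed.

End time_derivative.

(** * Preservation of the divergence constraint in continuous and in discrete time *)

Theorem theorem4 (R : realType) (M : mesh R) (Q : rules (R := R)) (p m : nat)
    (rho eta : bfield M)
    (p_ge1 : (1 <= p)%N) (m_eq : m = (p - 1)%N \/ m = p)
    (Q_ok : admissible M Q m)
    (rho_V : Vh p rho) (rho_pos : positive_nodal Q p rho)
    (eta_V : Vh 0 eta)
    (eta_ge0 : forall K x y, cell K (x, y) -> 0 <= eta K x y) :
  (forall (T : R) (u B : R -> vfield M) (e : R -> bfield M)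
      (J E : R -> vfield M),
    semidiscrete_solution Q p m rho eta T u B e J E ->
    Rh m (B 0).1 -> divfree (B 0).1 ->
    forall t : R, 0 <= t <= T -> Rh m (B t).1 /\ divfree (B t).1)
  /\
  (forall (s N : nat) (a : 'I_s -> 'I_s -> R) (b : 'I_s -> R) (tau : nat -> R)
      (u B : nat -> vfield M) (e : nat -> bfield M)
      (us Bs : nat -> 'I_s -> vfield M) (es : nat -> 'I_s -> bfield M)
      (Js Es : nat -> 'I_s -> vfield M),
    Xh p (u 0%N) -> Bh m (B 0%N) -> Vh p (e 0%N) ->
    (forall n, (n < N)%N ->
      rk_step Q p m rho eta a b (tau n) (u n) (B n) (e n)
        (us n) (Bs n) (es n) (Js n) (Es n) (u n.+1) (B n.+1) (e n.+1)) ->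
    Rh m (B 0%N).1 -> divfree (B 0%N).1 ->
    (forall n (i : 'I_s), (n < N)%N ->
      Rh m (Bs n i).1 /\ divfree (Bs n i).1) /\
    (forall n, (n <= N)%N -> Rh m (B n).1 /\ divfree (B n).1)).
Proof.
split=> [T u B e J E [_ Breg _ alg evol] _ div0 t tT|].
  (* Membership in [Rh] is part of being a solution; what has to be propagated in time is the
     divergence. *)
  have [_ HBt _ _] := alg t tT; split=> [|K x y Kxy]; first by case: HBt.
  have /andP[t0 tleT] := tT.
  have T0 : 0 <= (0 : R) <= T by rewrite lexx (le_trans t0 tleT).
  have [_ HB0 _ _] := alg 0 T0.
  have [C HC divC] := div2_riesz Q_ok Kxy.
  (* The zero on the right is replaced by the initial divergence at the same point, so both sides
     become values of one scalar function of time, the pairing with the fixed field [C]. *)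
  rewrite divC// -[RHS](div0 K x y Kxy) [RHS]divC//.
  have [->//|tne0] := eqVneq t 0; have tgt0 : 0 < t by rewrite lt_neqAle eq_sym tne0.
  apply/eqP; rewrite -subr_eq0; apply/eqP.
  (* The mean value theorem fits the data: a derivative is required only in the open interval, where
     the evolution equation holds, and continuity up to the end points, where it does not. *)
  have [z|w|c _ ->] := @MVT R (fun z => ipB Q (B z) C) (fun=> 0) 0 t tgt0.
  - rewrite in_itv /= => /andP[z0 zt].
    have zT : 0 < z < T by rewrite z0 (lt_le_trans zt).
    have zT' : 0 <= z <= T by rewrite !ltW//; case/andP: zT.
    have [_ evolB _] := evol z zT; have [_ _ _ [_ HE _ _]] := alg z zT'.
    have sE : smooth_field (E z).2 by case: HE => _ [/bQ_smooth_field].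
    (* The representation is now read backwards for the field [curl (E z)], which lies in [Bh]: its
       pairing with [C] is its divergence at the point. *)
    have curl0 : ipB Q (curl (E z)) C = 0.
      exact: etrans (esym (divC _ (curl_Bh HE))) (div2_curl K x y sE).
    have dB0 : ipB Q (vdt B z) C = 0 by have := evolB C HC; rewrite curl0 addr0.
    apply: (is_derive_eq _ dB0).
    have [r1 r2 r3] := Breg.
    by apply: is_derive_ipB => L s1 s2;
      [have [_] := r1 L s1 s2|have [_] := r2 L s1 s2|have [_] := r3 L s1 s2]; exact.
  - apply: continuous_subspaceW (within_continuous_ipB (Q := Q) (C := C) Breg) w.
    by move=> s; rewrite /= !in_itv /= => /andP[-> st]; exact: le_trans st tleT.
  - by rewrite mul0r.
move=> s N a b tau u B e us Bs es Js Es _ _ _ step R0 div0.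
(* This rests only on [Es n i] lying in [Ah], not on the magnetic field at level n, so it comes
   before the induction over time levels. *)
have stage n (i : 'I_s) : (n < N)%N -> Rh_divfree m (curl (Es n i)).1.
  by move=> /step[/(_ i)[_ _ [_ HE _ _]] _ _ _ _]; exact: Rh_divfree_curl.
have level n : (n <= N)%N -> Rh_divfree m (B n).1.
  elim: n => [|n IHn] nN; first by split.
  have [_ _ -> _ _] := step n nN.
  by apply: Rh_divfree_vstep => [|j]; [exact/IHn/ltnW|exact: stage].
split=> [n i nN|n nN]; last exact: level.
have [_ -> _ _ _] := step n nN.
by apply: Rh_divfree_vstep => [|j]; [exact/level/ltnW|exact: stage].
Qed.
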